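(* Let $k$ be a countable algebraically closed field. Then there exists a finitely generated (affine) $k$-algebra $A$ which is right Goldie, not simple, and just infinite over $k$, but which is not stably just infinite.
   Context: All rings are associative unital algebras over a field. A $k$-algebra $A$ is called just infinite (dimensional) if $\dim_k(A)=\infty$ and every nonzero two-sided ideal of $A$ has finite codimension in $A$. A just infinite $k$-algebra $A$ is called stably just infinite if $A\otimes_k K$ is just infinite over $K$ for every field extension $K/k$. *)

(* Defs.v *)
From HB Require Import structures.
From mathcomp Require Import all_boot all_order all_algebra.
Set Implicit Arguments. Unset Strict Implicit. Unset Printing Implicit Defensive.
Import GRing.Theory.
Local Open Scope ring_scope.

Definition lin_comb (F : fieldType) (V : lmodType F) (n : nat)
  (c : 'I_n -> F) (s : 'I_n -> V) : V := \sum_(i < n) c i *: s i.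

Definition lin_indep (F : fieldType) (V : lmodType F) (n : nat) (s : 'I_n -> V) :=
  forall c : 'I_n -> F, lin_comb c s = 0 -> forall i, c i = 0.

Definition finite_dim (F : fieldType) (A : algType F) :=
  exists n (s : 'I_n -> A), forall a : A, exists c : 'I_n -> F, a = lin_comb c s.

Definition two_sided_ideal (F : fieldType) (A : algType F) (I : A -> Prop) :=
  [/\ I 0, (forall x y, I x -> I y -> I (x + y)),
      (forall (c : F) x, I x -> I (c *: x)),
      (forall a x, I x -> I (a * x)) & (forall a x, I x -> I (x * a))].

Definition right_ideal (F : fieldType) (A : algType F) (I : A -> Prop) :=
  [/\ I 0, (forall x y, I x -> I y -> I (x + y)) & (forall a x, I x -> I (x * a))].

Definition nonzero_set (F : fieldType) (A : algType F) (I : A -> Prop) :=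
  exists x, I x /\ x != 0.

Definition finite_codim (F : fieldType) (A : algType F) (I : A -> Prop) :=
  exists n (s : 'I_n -> A), forall a : A, exists c : 'I_n -> F, I (a - lin_comb c s).

Definition just_infinite (F : fieldType) (A : algType F) :=
  ~ finite_dim A /\
  forall I : A -> Prop, two_sided_ideal I -> nonzero_set I -> finite_codim I.

Definition not_simple (F : fieldType) (A : algType F) :=
  exists I : A -> Prop, [/\ two_sided_ideal I, nonzero_set I & exists a, ~ I a].

Definition subalg_closed (F : fieldType) (A : algType F) (P : A -> Prop) :=
  [/\ P 1, (forall x y, P x -> P y -> P (x + y)),
      (forall (c : F) x, P x -> P (c *: x)) & (forall x y, P x -> P y -> P (x * y))].

Definition fin_gen_algebra (F : fieldType) (A : algType F) :=
  exists n (s : 'I_n -> A), forall a : A,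
    forall P : A -> Prop, subalg_closed P -> (forall i, P (s i)) -> P a.

Definition r_ann (F : fieldType) (A : algType F) (S : A -> Prop) (a : A) :=
  forall x, S x -> x * a = 0.

Definition right_goldie (F : fieldType) (A : algType F) :=
  (~ exists I : nat -> A -> Prop,
       (forall m, right_ideal (I m) /\ nonzero_set (I m)) /\
       (forall n (x : 'I_n -> A), (forall i : 'I_n, I i (x i)) ->
           \sum_(i < n) x i = 0 -> forall i, x i = 0)) /\
  (forall S : nat -> A -> Prop,
     (forall m a, r_ann (S m) a -> r_ann (S m.+1) a) ->
     exists N, forall m, (N <= m)%N -> forall a, r_ann (S m) a -> r_ann (S N) a).

(* (B, phi) is the scalar extension A ⊗_k K of the k-algebra A along the field
   extension iota : k -> K: phi is a k-algebra map (k acting on B through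
   iota) whose K-linear extension A ⊗_k K -> B is bijective (surjective: the
   image spans B over K; injective: k-independent families go to
   K-independent families). *)
Definition scalar_extension (k K : fieldType) (iota : {rmorphism k -> K})
  (A : algType k) (B : algType K) (phi : A -> B) :=
  [/\ (forall x y, phi (x + y) = phi x + phi y),
      (forall x y, phi (x * y) = phi x * phi y),
      phi 1 = 1 &
      (forall (c : k) x, phi (c *: x) = iota c *: phi x)] /\
  (forall b : B, exists n (s : 'I_n -> A) (c : 'I_n -> K),
      b = lin_comb c (fun i => phi (s i))) /\
  (forall n (s : 'I_n -> A), lin_indep s -> lin_indep (fun i => phi (s i))).

Definition stably_just_infinite (k : fieldType) (A : algType k) :=
  just_infinite A /\
  forall (K : fieldType) (iota : {rmorphism k -> K}) (B : algType K) (phi : A -> B),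
    scalar_extension iota phi -> just_infinite B.

(* Main.v *)
Require Import Defs.
From HB Require Import structures.
From mathcomp Require Import all_boot all_order all_algebra.
From mathcomp Require Import finmap monalg boolp zify ring.
Set Implicit Arguments. Unset Strict Implicit. Unset Printing Implicit Defensive.
Import Order.TTheory GRing.Theory Num.Theory.
Local Open Scope fset_scope.
Local Open Scope ring_scope.

(* Let F = k(t), and let T be a twisted group algebra over F of the wreath product of Z by Z,
   generated by units u and z: writing u_i = z^-i u z^i, the conjugates of u satisfy
   u_i u_j = (b_{i-j} / b_{j-i}) u_j u_i, where (b_n) takes its values in F^* and hits each of
   them infinitely often, at sparse indices n > 0.
   As F is countable, the commutators of the u_i yield all the scalars of F^*, so T is
   finitely generated over k even though its center contains F. The group is bi-orderable and
   amenable, hence T is an Ore domain, and the pairing is nondegenerate, hence T is simple.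

   With the nonunit w = 1 + z, put A = k + wT. Simplicity of T shows that wT is contained in
   every nonzero ideal of A, and that A is again finitely generated; A is a right Ore domain
   because T is. Finally the F-algebra T receives a map from the tensor product of A and F
   over k; its image contains wT, which is infinite dimensional over F, and its kernel is
   nonzero because F is already contained in T. *)

Notation lau := {malg int[int]}.

Definition shift (n : int) (x : lau) : lau :=
  \sum_(i <- msupp x) << x@_i *g i + n >>.

Lemma mcoeff_shift n x i : (shift n x)@_i = x@_(i - n).
Proof.
rewrite raddf_sum [X in _ = X@_ _]monalgE raddf_sum; apply: eq_bigr => j _ /=.
by rewrite !mcoeffU -(inj_eq (addIr n) j) subrK.
Qed.

Lemma shift_is_zmod_morphism n : zmod_morphism (shift n).
Proof. by move=> x y; apply/malgP => i; rewrite [RHS]mcoeffB !mcoeff_shift [LHS]mcoeffB. Qed.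

HB.instance Definition _ n := GRing.isZmodMorphism.Build lau lau (shift n)
  (shift_is_zmod_morphism n).

Lemma shiftU n i a : shift n << a *g i >> = << a *g i + n >>.
Proof.
apply/malgP => j; rewrite mcoeff_shift !mcoeffU.
by rewrite -(inj_eq (addIr n) i) subrK.
Qed.

Lemma shift_add m n x : shift (m + n) x = shift m (shift n x).
Proof. by apply/malgP => i; rewrite !mcoeff_shift opprD addrA. Qed.

Lemma shift0 x : shift 0 x = x.
Proof. by apply/malgP => i; rewrite mcoeff_shift subr0. Qed.

(** * Bicharacters of the base group and the resulting cocycle on the wreath product *)

Section Exponential.
Variables (F : fieldType).
Implicit Types (w : int -> F) (x : lau).

(** For [w] without zeros, the multiplicative character of the base group with value [w i] at the
    generator [<< i >>]. *)
Definition expw w x : F := \prod_(i <- msupp x) w i ^ x@_i.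

Lemma expw_fset w (d : {fset int}) x : msupp x `<=` d ->
  expw w x = \prod_(i <- d) w i ^ x@_i.
Proof.
by move=> le_xd; apply: big_fset_incl => // i _ /mcoeff_outdom ->; rewrite expr0z.
Qed.

Lemma expw_neq0 w x : (forall i, w i != 0) -> expw w x != 0.
Proof.
move=> w0; apply: (big_ind (fun a => a != 0)) => [|a c|i _]; first exact: oner_neq0.
  exact: mulf_neq0.
exact: expfz_neq0.
Qed.

Lemma expwD w x y : (forall i, w i != 0) -> expw w (x + y) = expw w x * expw w y.
Proof.
move=> w0; rewrite (expw_fset _ (msuppD_le x y)).
rewrite (expw_fset _ (fsubsetUl (msupp x) (msupp y))).
rewrite (expw_fset _ (fsubsetUr (msupp x) (msupp y))) -big_split /=.
by apply: eq_bigr => i _; rewrite mcoeffD expfzDr.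
Qed.

Lemma expw0 w : expw w 0 = 1.
Proof. by rewrite /expw msupp0 big_seq_fset0. Qed.

Lemma expwM w v x : expw (fun i => w i * v i) x = expw w x * expw v x.
Proof. by rewrite -big_split /=; apply: eq_bigr => i _; rewrite expfzMl. Qed.

Lemma expw1 x : expw (fun=> 1) x = 1.
Proof. by rewrite /expw big1 // => i _; rewrite exp1rz. Qed.

Lemma eq_expw w v x : w =1 v -> expw w x = expw v x.
Proof. by move=> wv; apply: eq_bigr => i _; rewrite wv. Qed.

Lemma expwU w i a : expw w << a *g i >> = w i ^ a.
Proof. by rewrite (expw_fset _ msuppU_le) big_seq_fset1 mcoeffUU. Qed.

Lemma expw_shift w n x : expw w (shift n x) = expw (fun i => w (i + n)) x.
Proof.
have le : msupp (shift n x) `<=` [fset i + n | i in msupp x].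
  apply/fsubsetP => i; rewrite -mcoeff_neq0 mcoeff_shift mcoeff_neq0 => xi.
  by apply/imfsetP; exists (i - n); rewrite ?subrK.
rewrite (expw_fset _ le) big_imfset /=; last by move=> i j _ _; apply: addIr.
by apply: eq_bigr => i _; rewrite mcoeff_shift addrK.
Qed.
End Exponential.

Record twist (F : fieldType) := Twist {
  twist_val :> int -> F;
  twist_neq0 : forall i, twist_val i != 0 }.

Section Bicharacter.
Variables (F : fieldType) (b : twist F).
Implicit Types x y z : lau.

(** The bimultiplicative extension of [b (i - j)] from generators. Since only the difference
    matters, it is invariant under translation. *)
Definition bichar x y : F := expw (fun i => expw (fun j => b (i - j)) y) x.

Let b0 i y : expw (fun j => b (i - j)) y != 0.
Proof. by apply: expw_neq0 => j; apply: twist_neq0. Qed.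

Lemma bichar_neq0 x y : bichar x y != 0.
Proof. exact: expw_neq0. Qed.

Lemma bicharDl x y z : bichar (x + y) z = bichar x z * bichar y z.
Proof. exact: expwD. Qed.

Lemma bicharDr x y z : bichar x (y + z) = bichar x y * bichar x z.
Proof.
rewrite -expwM; apply: eq_expw => i; apply: expwD => j; exact: twist_neq0.
Qed.

Lemma bichar0l x : bichar 0 x = 1. Proof. exact: expw0. Qed.

Lemma bichar0r x : bichar x 0 = 1.
Proof. by rewrite -[RHS](expw1 F x); apply: eq_expw => i; apply: expw0. Qed.

Lemma bicharNr x y : bichar x (- y) = (bichar x y)^-1.
Proof.
rewrite -[RHS]mul1r; apply: canRL (mulfK (bichar_neq0 _ _)) _.
by rewrite -bicharDr addNr bichar0r.
Qed.

Lemma bichar_shift n x y : bichar (shift n x) (shift n y) = bichar x y.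
Proof.
rewrite [LHS]expw_shift; apply: eq_expw => i; rewrite expw_shift.
by apply: eq_expw => j; congr (b _); ring.
Qed.

Lemma bicharUU i j : bichar << i >> << j >> = b (i - j).
Proof. by rewrite /bichar !expwU. Qed.

Lemma bicharU i y : bichar << i >> y = expw (fun j => b (i - j)) y.
Proof. by rewrite /bichar expwU. Qed.

Lemma bichar_U x j : bichar x << j >> = expw (fun i => b (i - j)) x.
Proof. by apply: eq_expw => i; rewrite expwU. Qed.

End Bicharacter.

(* The wreath product of Z by Z, written as z^n x. *)
Definition wreath : Type := (int * lau)%type.
HB.instance Definition _ := Choice.on wreath.

Definition wmul (g h : wreath) : wreath := (g.1 + h.1, shift h.1 g.2 + h.2).
Definition wone : wreath := (0, 0).
Definition winv (g : wreath) : wreath := (- g.1, - shift (- g.1) g.2).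

Lemma wmulA : associative wmul.
Proof.
move=> [i x] [j y] [k z]; rewrite /wmul /=; congr pair; first exact: addrA.
by rewrite raddfD /= addrA [j + k]addrC shift_add.
Qed.

Lemma wmul1 g : wmul wone g = g.
Proof. by case: g => i x; rewrite /wmul /= raddf0 !add0r. Qed.

Lemma wmulr1 g : wmul g wone = g.
Proof. by case: g => i x; rewrite /wmul /= shift0 !addr0. Qed.

Lemma wmulV g : wmul g (winv g) = wone.
Proof. by case: g => i x; rewrite /wmul /= !subrr. Qed.

Lemma wmulVg g : wmul (winv g) g = wone.
Proof.
case: g => i x; rewrite /wmul /= addNr raddfN /= -shift_add subrr shift0.
by rewrite addNr.
Qed.

Lemma wmulI g : injective (wmul g).
Proof. by apply: (can_inj (g := wmul (winv g))) => h; rewrite wmulA wmulVg wmul1. Qed.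

Lemma wmulIr g : injective (wmul^~ g).
Proof. by apply: (can_inj (g := wmul^~ (winv g))) => h /=; rewrite -wmulA wmulV wmulr1. Qed.

(** Moving x past z^j turns it into its translate by j; what remains is a product in the base group,
    where [bichar] supplies the scalar. *)
Definition cocyc (F : fieldType) (b : twist F) (g h : wreath) : F :=
  bichar b (shift h.1 g.2) h.2.

Section Cocycle.
Variables (F : fieldType) (b : twist F).
Lemma cocyc_neq0 g h : cocyc b g h != 0. Proof. exact: bichar_neq0. Qed.

Lemma cocyc1 g : cocyc b wone g = 1.
Proof. by rewrite /cocyc raddf0 bichar0l. Qed.

Lemma cocycr1 g : cocyc b g wone = 1.
Proof. by rewrite /cocyc bichar0r. Qed.

(** The 2-cocycle identity behind associativity; bimultiplicativity and translation invariance of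
    [bichar] give it. *)
Lemma cocycA g h l :
  cocyc b g h * cocyc b (wmul g h) l = cocyc b g (wmul h l) * cocyc b h l.
Proof.
case: g h l => [i x] [j y] [k z]; rewrite /cocyc /= raddfD /= bicharDl bicharDr.
by rewrite [j + k]addrC (shift_add k j x) bichar_shift mulrA.
Qed.
End Cocycle.

(** * The twisted group algebra *)

Definition tga (F : fieldType) (b : twist F) : Type := {malg F[wreath]}.
HB.instance Definition _ (F : fieldType) (b : twist F) :=
  GRing.Zmodule.on (tga b).

Section TwistedRing.
Variables (F : fieldType) (b : twist F).
Implicit Types x y z : tga b.

Definition tmon (g : wreath) (a : F) : tga b := << a *g g >>.

HB.instance Definition _ g := GRing.isZmodMorphism.Build F (tga b) (tmon g)
  (fun a c => monalgUB (G := F) g a c).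

Definition tcoef (g : wreath) (x : tga b) : F := mcoeff g x.

HB.instance Definition _ g := GRing.isZmodMorphism.Build (tga b) F (tcoef g)
  (fun x y => mcoeffB (G := F) g x y).

Definition tsupp x : {fset wreath} := msupp (x : {malg F[wreath]}).

Lemma tcoefP x y : (forall g, tcoef g x = tcoef g y) -> x = y.
Proof. by move=> xy; apply/malgP. Qed.

Lemma tcoef_mon g a h : tcoef h (tmon g a) = a *+ (g == h).
Proof. exact: mcoeffU. Qed.

Lemma tsuppE x g : (g \in tsupp x) = (tcoef g x != 0).
Proof. by rewrite mcoeff_neq0. Qed.

Lemma tcoef_out x g : g \notin tsupp x -> tcoef g x = 0.
Proof. exact: mcoeff_outdom. Qed.

Lemma tgaE x : x = \sum_(g <- tsupp x) tmon g (tcoef g x).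
Proof. exact: monalgE. Qed.

Definition tmul x y : tga b :=
  \sum_(g <- tsupp x) \sum_(h <- tsupp y)
     tmon (wmul g h) (tcoef g x * tcoef h y * cocyc b g h).

Definition tone : tga b := tmon wone 1.

(** Larger index sets add only zero terms, so products of elements with different supports can be
    compared over a common set. *)
Lemma tmul_fset (d1 d2 : {fset wreath}) x y : tsupp x `<=` d1 -> tsupp y `<=` d2 ->
  tmul x y = \sum_(g <- d1) \sum_(h <- d2)
     tmon (wmul g h) (tcoef g x * tcoef h y * cocyc b g h).
Proof.
move=> le1 le2; rewrite /tmul (big_fset_incl _ le1) /=.
  apply: eq_bigr => g _; apply: big_fset_incl => // h _ /tcoef_out ->.
  by rewrite mulr0 mul0r raddf0.
by move=> g _ /tcoef_out ->; apply: big1 => h _; rewrite !mul0r raddf0.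
Qed.

Let tsuppD x y : tsupp (x + y) `<=` tsupp x `|` tsupp y.
Proof. exact: msuppD_le. Qed.

Lemma tmulDl : left_distributive tmul +%R.
Proof.
move=> x y z; rewrite (tmul_fset (tsuppD x y) (fsubset_refl _)).
rewrite (tmul_fset (fsubsetUl _ (tsupp y)) (fsubset_refl _)).
rewrite (tmul_fset (fsubsetUr (tsupp x) _) (fsubset_refl _)).
rewrite -big_split /=; apply: eq_bigr => g _; rewrite -big_split /=.
by apply: eq_bigr => h _; rewrite raddfD !mulrDl raddfD.
Qed.

Lemma tmulDr : right_distributive tmul +%R.
Proof.
move=> z x y; rewrite (tmul_fset (fsubset_refl _) (tsuppD x y)).
rewrite (tmul_fset (fsubset_refl _) (fsubsetUl _ (tsupp y))).
rewrite (tmul_fset (fsubset_refl _) (fsubsetUr (tsupp x) _)).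
rewrite -big_split /=; apply: eq_bigr => g _; rewrite -big_split /=.
by apply: eq_bigr => h _; rewrite raddfD mulrDr mulrDl raddfD.
Qed.

Lemma tmul0 x : tmul 0 x = 0.
Proof. by apply: (addrI (tmul 0 x)); rewrite -tmulDl !addr0. Qed.

Lemma tmulr0 x : tmul x 0 = 0.
Proof. by apply: (addrI (tmul x 0)); rewrite -tmulDr !addr0. Qed.

Lemma tmulUU g a h c :
  tmul (tmon g a) (tmon h c) = tmon (wmul g h) (a * c * cocyc b g h).
Proof.
rewrite (tmul_fset (msuppU_le (k := g)) (msuppU_le (k := h))) !big_seq_fset1.
by rewrite !tcoef_mon !eqxx.
Qed.

Lemma tga_ind (P : tga b -> Prop) :
  P 0 -> (forall x y, P x -> P y -> P (x + y)) -> (forall g a, P (tmon g a)) ->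
  forall x, P x.
Proof.
by move=> P0 PD PU x; rewrite (tgaE x); apply: big_ind => // g _; apply: PU.
Qed.

Lemma tmulA : associative tmul.
Proof.
move=> x y z; elim/tga_ind: x => [|x1 x2 e1 e2|g a]; first by rewrite !tmul0.
  by rewrite !tmulDl e1 e2.
elim/tga_ind: y => [|x1 x2 e1 e2|h c]; first by rewrite !(tmul0, tmulr0).
  by rewrite !(tmulDl, tmulDr) e1 e2.
elim/tga_ind: z => [|x1 x2 e1 e2|l d]; first by rewrite !(tmul0, tmulr0).
  by rewrite !tmulDr e1 e2.
rewrite !tmulUU wmulA; congr (tmon _ _).
have := cocycA b g h l; set A := cocyc b g h; set B := cocyc b (wmul g h) l => e.
have -> : a * c * A * d * B = a * c * d * (A * B) by ring.
by rewrite e; ring.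
Qed.

Lemma tmul1 : left_id tone tmul.
Proof.
elim/tga_ind => [|x1 x2 e1 e2|g a]; first by rewrite tmulr0.
  by rewrite tmulDr e1 e2.
by rewrite tmulUU wmul1 cocyc1 mul1r mulr1.
Qed.

Lemma tmulr1 : right_id tone tmul.
Proof.
elim/tga_ind => [|x1 x2 e1 e2|g a]; first by rewrite tmul0.
  by rewrite tmulDl e1 e2.
by rewrite tmulUU wmulr1 cocycr1 !mulr1.
Qed.

Lemma tone_neq0 : tone != 0.
Proof.
apply/eqP => /(congr1 (tcoef wone)) /eqP.
by rewrite tcoef_mon eqxx raddf0 oner_eq0.
Qed.

HB.instance Definition _ := GRing.Zmodule_isNzRing.Build (tga b)
  tmulA tmul1 tmulr1 tmulDl tmulDr tone_neq0.

Lemma tmulE x y : x * y = \sum_(g <- tsupp x) \sum_(h <- tsupp y)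
     tmon (wmul g h) (tcoef g x * tcoef h y * cocyc b g h).
Proof. by []. Qed.

Lemma tmonM g a h c : tmon g a * tmon h c = tmon (wmul g h) (a * c * cocyc b g h).
Proof. exact: tmulUU. Qed.

Lemma tmon1 : tmon wone 1 = 1. Proof. by []. Qed.

Lemma tcoef1 g : tcoef g 1 = (wone == g)%:R.
Proof. exact: tcoef_mon. Qed.

Lemma tcoef_Ul g a x h :
  tcoef (wmul g h) (tmon g a * x) = a * tcoef h x * cocyc b g h.
Proof.
elim/tga_ind: x => [|x1 x2 e1 e2|l c]; first by rewrite mulr0 !raddf0 mulr0 mul0r.
  by rewrite mulrDr !raddfD /= e1 e2 mulrDr mulrDl.
rewrite tmonM !tcoef_mon (inj_eq (@wmulI g)); case: eqP => [->|_] //.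
by rewrite !mulr0n mulr0 mul0r.
Qed.

Lemma tcoef_Ur g a x h :
  tcoef (wmul h g) (x * tmon g a) = tcoef h x * a * cocyc b h g.
Proof.
elim/tga_ind: x => [|x1 x2 e1 e2|l c]; first by rewrite mul0r !raddf0 !mul0r.
  by rewrite mulrDl !raddfD /= e1 e2 !mulrDl.
rewrite tmonM !tcoef_mon (inj_eq (@wmulIr g)); case: eqP => [->|_] //.
by rewrite !mulr0n !mul0r.
Qed.

(** Scalars enter through this central embedding rather than a fixed module structure, so that
    several fields can act on the same ring. *)
Definition tconst (a : F) : tga b := tmon wone a.

Lemma tconst_is_monoid_morphism : monoid_morphism tconst.
Proof. by split=> // a c; rewrite tmonM wmul1 cocyc1 mulr1. Qed.

HB.instance Definition _ := GRing.isZmodMorphism.Build F (tga b) tconst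
  (fun a c => monalgUB (G := F) wone a c).
HB.instance Definition _ := GRing.isMonoidMorphism.Build F (tga b) tconst
  tconst_is_monoid_morphism.

Lemma tcoefZ a x g : tcoef g (tconst a * x) = a * tcoef g x.
Proof. by rewrite -{1}(wmul1 g) tcoef_Ul cocyc1 mulr1. Qed.

Lemma tconst_central a x : tconst a * x = x * tconst a.
Proof.
apply: tcoefP => g; rewrite tcoefZ -{2}(wmulr1 g) tcoef_Ur cocycr1 mulr1.
exact: mulrC.
Qed.

Lemma tmonE g a : tmon g a = tconst a * tmon g 1.
Proof. by rewrite tmonM wmul1 cocyc1 !mulr1. Qed.

Lemma tcoefM x y g : tcoef g (x * y) != 0 ->
  exists h l, [/\ tcoef h x != 0, tcoef l y != 0 & g = wmul h l].
Proof.
apply: contraPP => no; apply/negP; rewrite negbK; apply/eqP.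
rewrite tmulE raddf_sum big_seq big1 //= => h hx.
rewrite raddf_sum big_seq big1 //= => l ly; rewrite tcoef_mon.
case: eqP => // e; case: no; exists h, l; split=> //; by rewrite -tsuppE.
Qed.

Lemma tnz x : x != 0 -> exists g, tcoef g x != 0.
Proof.
move=> x0; apply: contrapT => no; case/eqP: x0; apply: tcoefP => g.
by rewrite raddf0; apply/eqP/negPn/negP => xg; apply: no; exists g.
Qed.

(** Pigeonhole on the finite support. *)
Lemma tsupp_avoid x (f : nat -> wreath) : injective f ->
  exists n, tcoef (f n) x = 0.
Proof.
move=> f_inj; apply: contrapT => no.
have sub : {subset [seq f i | i <- iota 0 (size (tsupp x)).+1] <= tsupp x}.
  by move=> _ /mapP[i _ ->]; rewrite tsuppE; apply/negP => /eqP ?; apply: no; exists i.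
have := uniq_leq_size _ sub; rewrite map_inj_uniq ?iota_uniq // => /(_ isT).
by rewrite size_map size_iota ltnn.
Qed.

End TwistedRing.

(** * Extension of the coefficient field *)

Section BaseChange.
Variables (F F' : fieldType) (f : {rmorphism F -> F'}) (b : twist F) (b' : twist F').
Hypothesis bb' : forall i, b' i = f (b i).

Definition tmap (x : tga b) : tga b' :=
  \sum_(g <- tsupp x) tmon b' g (f (tcoef g x)).

Lemma tcoef_map g x : tcoef g (tmap x) = f (tcoef g x).
Proof.
rewrite raddf_sum [X in _ = f (tcoef _ X)]tgaE !raddf_sum; apply: eq_bigr => h _ /=.
by rewrite !tcoef_mon rmorphMn.
Qed.

Lemma tmap_is_zmod_morphism : zmod_morphism tmap.
Proof. by move=> x y; apply: tcoefP => g; rewrite [RHS]raddfB /= !tcoef_map !raddfB. Qed.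

HB.instance Definition _ := GRing.isZmodMorphism.Build (tga b) (tga b') tmap
  tmap_is_zmod_morphism.

Lemma expw_map w x : expw (f \o w) x = f (expw w x).
Proof. by rewrite rmorph_prod; apply: eq_bigr => i _; rewrite fmorphXz. Qed.

Lemma cocyc_map g h : cocyc b' g h = f (cocyc b g h).
Proof.
rewrite -expw_map; apply: eq_expw => i /=; rewrite -expw_map.
by apply: eq_expw => j /=; rewrite bb'.
Qed.

Lemma tmapU g a : tmap (tmon b g a) = tmon b' g (f a).
Proof. by apply: tcoefP => h; rewrite tcoef_map !tcoef_mon rmorphMn. Qed.

Lemma tmap_is_monoid_morphism : monoid_morphism tmap.
Proof.
split=> [|x y]; first by rewrite -tmon1 tmapU rmorph1.
elim/tga_ind: x => [|x1 x2 e1 e2|g a]; first by rewrite !(mul0r, raddf0).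
  by rewrite mulrDl !raddfD /= mulrDl e1 e2.
elim/tga_ind: y => [|x1 x2 e1 e2|h c]; first by rewrite !(mulr0, raddf0).
  by rewrite mulrDr !raddfD /= mulrDr e1 e2.
by rewrite tmonM !tmapU tmonM cocyc_map !rmorphM.
Qed.

End BaseChange.

(** * The bi-order on the wreath product *)

Lemma seq_max (T : eqType) (R : T -> T -> Prop) (s : seq T) :
  (forall x y z, R x y -> R y z -> R x z) ->
  (forall x y, x = y \/ R x y \/ R y x) -> s != [::] ->
  exists2 m, m \in s & forall y, y \in s -> y = m \/ R y m.
Proof.
move=> R_trans R_total; elim: s => [//|x s IH _].
have [->|/IH[m ms mP]] := eqVneq s [::].
  by exists x => [|y]; rewrite inE // => /eqP ->; left.
have [xm|[xm|mx]] := R_total x m.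
- by exists x => [|y]; rewrite inE ?eqxx // => /predU1P[|/mP]; rewrite xm; [left|].
- by exists m => [|y]; rewrite inE ?ms ?orbT // => /predU1P[->|/mP]; [right|].
exists x => [|y]; rewrite inE ?eqxx // => /predU1P[|/mP[->|]]; [by left|by right|].
by move=> ym; right; apply: R_trans mx.
Qed.

(** The positive cone of the lexicographic order that reads sequences from the highest index
    down. *)
Definition lpos (x : lau) : Prop :=
  exists i, 0 < x@_i /\ forall j, i < j -> x@_j = 0.

Lemma lposD x y : lpos x -> lpos y -> lpos (x + y).
Proof.
move=> [i [xi xP]] [j [yj yP]].
have [lt_ij|lt_ji|eq_ij] := ltgtP i j.
- exists j; rewrite mcoeffD xP // add0r; split=> // k jk.
  by rewrite mcoeffD xP ?yP ?addr0 //; apply: lt_trans jk.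
- exists i; rewrite mcoeffD yP // addr0; split=> // k ik.
  by rewrite mcoeffD xP ?yP ?addr0 //; apply: lt_trans ik.
subst j; exists i; rewrite mcoeffD; split=> [|k ik]; first exact: addr_gt0.
by rewrite mcoeffD xP ?yP ?addr0.
Qed.

Lemma lpos_shift n x : lpos x -> lpos (shift n x).
Proof.
move=> [i [xi xP]]; exists (i + n); rewrite mcoeff_shift addrK; split=> // j ij.
by rewrite mcoeff_shift xP // ltrBrDr.
Qed.

Lemma lpos_total x : x = 0 \/ lpos x \/ lpos (- x).
Proof.
have [->|x0] := eqVneq x 0; [by left|right].
have : (msupp x : seq int) != [::].
  apply: contraNneq x0 => s0; apply/eqP/malgP => i; rewrite mcoeff0.
  by apply: mcoeff_outdom; rewrite -[i \in _]/(i \in (msupp x : seq int)) s0.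
have lt_tot (i j : int) : i = j \/ i < j \/ j < i.
  by case: (ltgtP i j); [right; left|right; right|left].
move=> /(seq_max (fun i j k => @lt_trans _ _ j i k) lt_tot) [i xi max_i].
have out j : i < j -> x@_j = 0.
  move=> ij; apply: mcoeff_outdom; apply/negP => /max_i[ji|/(lt_trans ij)].
    by rewrite ji ltxx in ij.
  by rewrite ltxx.
have : x@_i != 0 by rewrite mcoeff_neq0.
rewrite neq_lt => /orP[lt_x0|x_gt0]; [right|left]; exists i; last by [].
by rewrite mcoeffN oppr_gt0; split=> // j /out xj; rewrite mcoeffN xj oppr0.
Qed.

Lemma lpos0 : ~ lpos 0.
Proof. by move=> [i []]; rewrite mcoeff0 ltxx. Qed.

(** Degree in [z] first, then the cone [lpos]. The order is two-sided invariant because translations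
    preserve the cone and the base group is abelian. *)
Definition wlt (g h : wreath) : Prop :=
  g.1 < h.1 \/ (g.1 = h.1 /\ lpos (h.2 - g.2)).

Lemma wlt_trans g h l : wlt g h -> wlt h l -> wlt g l.
Proof.
move=> [gh|[gh pgh]] [hl|[hl phl]]; first by left; apply: lt_trans hl.
- by left; rewrite -hl.
- by left; rewrite gh.
right; rewrite gh hl; split=> //; rewrite -(subrK h.2 l.2) -addrA.
exact: lposD.
Qed.

Lemma wlt_irr g : ~ wlt g g.
Proof. by move=> [|[_]]; rewrite ?ltxx // subrr; apply: lpos0. Qed.

Lemma wlt_total g h : g = h \/ wlt g h \/ wlt h g.
Proof.
case: g h => [i x] [j y].
have [ij|ij|<-] := ltgtP i j; [by right; left; left|by right; right; left|].
have [/eqP|[pos|neg]] := lpos_total (y - x).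
- by rewrite subr_eq0 => /eqP ->; left.
- by right; left; right.
by right; right; right; rewrite -opprB.
Qed.

Lemma wlt_mull l g h : wlt g h -> wlt (wmul l g) (wmul l h).
Proof.
move=> [gh|[gh pgh]]; rewrite /wlt /wmul /= ?ltrD2l; first by left.
by right; rewrite gh opprD addrACA subrr add0r.
Qed.

Lemma wlt_mulr l g h : wlt g h -> wlt (wmul g l) (wmul h l).
Proof.
move=> [gh|[gh pgh]]; rewrite /wlt /wmul /= ?ltrD2r; first by left.
right; split; first by rewrite gh.
by rewrite [shift _ g.2 + _]addrC addrKA -(raddfB (shift l.1)); apply: lpos_shift.
Qed.

(** * Absence of zero divisors, and the nonunit [1 + z] *)

Section Domain.
Variables (F : fieldType) (b : twist F).
Implicit Types x y : tga b.

Lemma tsupp_max (R : wreath -> wreath -> Prop) x :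
  (forall g h l, R g h -> R h l -> R g l) ->
  (forall g h, g = h \/ R g h \/ R h g) -> x != 0 ->
  exists2 m, tcoef m x != 0 & forall g, tcoef g x != 0 -> g = m \/ R g m.
Proof.
move=> R_trans R_total /tnz[g]; rewrite -tsuppE => xg.
have : (tsupp x : seq wreath) != [::].
  apply/eqP => s0; move: xg.
  by rewrite -[g \in _]/(g \in (tsupp x : seq wreath)) s0.
move=> /(seq_max R_trans R_total)[m xm mP]; exists m; first by rewrite -tsuppE.
by move=> h; rewrite -tsuppE; apply: mP.
Qed.

(** The largest terms of [x] and [y] have a product that no other pair of terms can reach, as the
    order is invariant on both sides. *)
Theorem tga_domain x y : x != 0 -> y != 0 -> x * y != 0.
Proof.
move=> /(tsupp_max wlt_trans wlt_total)[g xg gP].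
move=> /(tsupp_max wlt_trans wlt_total)[h yh hP].
apply: contraNneq (mulf_neq0 (mulf_neq0 xg yh) (cocyc_neq0 b g h)) => xy0.
(* Without its largest term, [x] only yields products strictly below [wmul g h]. *)
pose x' := x - tmon b g (tcoef g x).
have : tcoef (wmul g h) (x * y) = 0 by rewrite xy0 raddf0.
rewrite -{1}(subrK (tmon b g (tcoef g x)) x) mulrDl raddfD /= tcoef_Ul -/x'.
suff -> : tcoef (wmul g h) (x' * y) = 0 by rewrite add0r => ->.
apply/eqP/negPn/negP => /tcoefM[g' [h' [x'g' yh' e]]].
have gg' : g' != g.
  by apply: contraNneq x'g' => ->; rewrite raddfB /= tcoef_mon eqxx subrr.
have lt_g : wlt g' g.
  have /gP[e'|//] : tcoef g' x != 0; last by rewrite e' eqxx in gg'.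
  by move: x'g'; rewrite raddfB /= tcoef_mon [g == g']eq_sym (negPf gg') subr0.
suff : wlt (wmul g' h') (wmul g h) by rewrite e; apply: wlt_irr.
have [->|lt_h] := hP _ yh'; first exact: wlt_mulr.
exact: wlt_trans (wlt_mulr _ lt_g) (wlt_mull _ lt_h).
Qed.

Definition tz : tga b := tmon b (1, 0) 1.

Lemma tcoef_1z_mul x g : tcoef g ((1 + tz) * x) =
  tcoef g x + tcoef (wmul (-1, 0) g) x.
Proof.
rewrite mulrDl mul1r raddfD /=; congr (_ + _).
have eg : g = wmul (1, 0) (wmul (-1, 0) g).
  by rewrite wmulA [wmul (1, 0) _](_ : _ = wone) ?wmul1 // /wmul /= raddf0 addr0.
by rewrite {1}eg tcoef_Ul mul1r /cocyc raddf0 bichar0l mulr1.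
Qed.

Lemma wlt_z g : wlt (wmul (-1, 0) g) g.
Proof. by left => /=; rewrite -ltrBrDr subrr. Qed.

(* The lowest and highest terms of [(1 + z) x] are distinct. *)
Lemma tga_1z_nonunit x : (1 + tz) * x != 1.
Proof.
apply/eqP => e; have x0 : x != 0.
  by apply: contra_eqN e => /eqP ->; rewrite mulr0 eq_sym oner_eq0.
have [g xg gP] := tsupp_max wlt_trans wlt_total x0.
have tot (h l : wreath) : h = l \/ wlt l h \/ wlt h l.
  by have [|[]] := wlt_total h l; tauto.
have [h xh hP] := tsupp_max (R := fun g h => wlt h g)
  (fun g h l gh hl => wlt_trans hl gh) tot x0.
have out_h : tcoef (wmul (-1, 0) h) x = 0.
  apply/eqP/negPn/negP => /hP[eh|/wlt_trans/(_ (wlt_z h))/wlt_irr //].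
  by case: (@wlt_irr h); rewrite -{1}eh; apply: wlt_z.
have ezg : wmul (-1, 0) (wmul (1, 0) g) = g.
  by rewrite wmulA [wmul (-1, 0) _](_ : _ = wone) ?wmul1 // /wmul /= raddf0 addr0.
have lt_g : wlt g (wmul (1, 0) g) by rewrite -{1}ezg; apply: wlt_z.
have out_g : tcoef (wmul (1, 0) g) x = 0.
  apply/eqP/negPn/negP => /gP[eg|/(wlt_trans lt_g)/wlt_irr //].
  by case: (@wlt_irr g); rewrite -{2}eg.
have := tcoef_1z_mul x h; rewrite e out_h addr0 tcoef1.
have := tcoef_1z_mul x (wmul (1, 0) g); rewrite e out_g ezg add0r tcoef1.
case: eqP => [eg _|_ /esym/eqP]; last by rewrite (negPf xg).
case: eqP => [eh _|_ /esym/eqP]; last by rewrite (negPf xh).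
have [ehg|] := gP _ xh.
  by case: (@wlt_irr h); rewrite {1}ehg -eh eg.
by rewrite -eh eg => /(wlt_trans lt_g)/wlt_irr.
Qed.

End Domain.

(** * Amenability of the wreath product *)

Lemma expn_shift_ratio (e w p : nat) : exists K, forall M, (K <= M)%N ->
  (p * (M + e) ^ w <= p.+1 * M ^ w)%N.
Proof.
elim: w p => [|w IH] p; first by exists 0%N => M _; rewrite !expn0; lia.
(* Both the power and the new factor grow by at most (2p+2)/(2p+1), and p(2p+2)^2 <=
   (p+1)(2p+1)^2. *)
have [K KP] := IH (2 * p).+1; exists (maxn K ((2 * p).+1 * e)) => M.
rewrite geq_max => /andP[/KP le1 le2].
have le3 : ((2 * p).+1 * (M + e) <= (2 * p).+2 * M)%N by lia.
have := leq_mul le1 le3; rewrite !expnSr.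
move: ((M + e) ^ w)%N (M ^ w)%N => a c le4.
have e0 : (0 < (2 * p).+1 * (2 * p).+1)%N by [].
rewrite -(leq_pmul2l e0).
set q := (2 * p).+1 in le4 *.
have -> : (q * q * (p * (a * (M + e))) = p * (q * a * (q * (M + e))))%N by ring.
apply: leq_trans (leq_mul (leqnn p) le4) _.
have -> : (p * (q.+1 * c * (q.+1 * M)) = (p * (q.+1 * q.+1)) * (c * M))%N by ring.
have -> : (q * q * (p.+1 * (c * M)) = (q * q * p.+1) * (c * M))%N by ring.
by apply: leq_mul => //; rewrite /q; nia.
Qed.

Definition int_range (lo : int) (n : nat) : seq int := [seq lo + i%:Z | i <- iota 0 n].

Lemma mem_int_range lo n i : (i \in int_range lo n) = (lo <= i < lo + n%:Z).
Proof.
apply/mapP/idP => [[k]|/andP[le_i lt_i]]; first by rewrite mem_iota => ? ->; lia.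
by exists (absz (i - lo)); rewrite ?mem_iota; lia.
Qed.

Lemma uniq_int_range lo n : uniq (int_range lo n).
Proof. by rewrite map_inj_uniq ?iota_uniq // => i j /addrI[]. Qed.

Lemma size_int_range lo n : size (int_range lo n) = n.
Proof. by rewrite size_map size_iota. Qed.

Fixpoint box (s : seq int) (lo : int) (n : nat) : seq lau :=
  if s is i :: s' then
    [seq << c *g i >> + x | c <- int_range lo n, x <- box s' lo n]
  else [:: 0].

Lemma size_box s lo n : size (box s lo n) = (n ^ size s)%N.
Proof. by elim: s => //= i s IH; rewrite size_allpairs size_int_range IH expnS. Qed.

Lemma mem_box s lo n (x : lau) : uniq s ->
  reflect (forall i, if i \in s then is_true (lo <= x@_i < lo + n%:Z) else x@_i = 0)
          (x \in box s lo n).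
Proof.
elim: s x => [|j s IH] x /= => [_|/andP[js us]].
  rewrite inE; apply: (iffP eqP) => [-> i|x0]; first by rewrite mcoeff0.
  by apply/malgP => i; rewrite mcoeff0.
apply: (iffP allpairsP) => [[[c y] /= [cr /(IH _ us) yP ->]] i|xP].
  rewrite inE mcoeffD mcoeffU; have := yP i; case: (eqVneq i j) => [->|ij] /=.
    by rewrite (negPf js) => ->; rewrite addr0 -mem_int_range.
  by rewrite add0r.
exists (x@_j, x - << x@_j *g j >>); split=> /=; last by rewrite addrC subrK.
  by have := xP j; rewrite inE eqxx /= mem_int_range.
apply/(IH _ us) => i; have := xP i; rewrite inE mcoeffB mcoeffU.
case: (eqVneq i j) => [->|ij] /=; last by rewrite subr0.
by rewrite (negPf js) subrr.
Qed.

Lemma uniq_box s lo n : uniq s -> uniq (box s lo n).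
Proof.
elim: s => [|i s IH] //= /andP[i_s us].
apply: allpairs_uniq; rewrite ?uniq_int_range ?IH //.
move=> [c x] [c' x'] /allpairsP[[c1 x1] /= [_ xb [-> ->]]].
move=> /allpairsP[[c2 x2] /= [_ xb' [-> ->]]] e.
move: xb xb' => /(mem_box _ _ _ us)/(_ i)+ /(mem_box _ _ _ us)/(_ i).
rewrite (negPf i_s) => xi xi'; have := congr1 (mcoeff i) e.
rewrite !mcoeffD !mcoeffUU xi xi' !addr0 => ec.
by move: e; rewrite ec => /addrI ->.
Qed.

Definition bounded (d : nat) (g : wreath) : Prop :=
  (absz g.1 <= d)%N /\
  forall i, (absz g.2@_i <= d)%N /\ (g.2@_i != 0 -> (absz i <= d)%N).

Lemma seq_bounded (s : seq wreath) : exists d, forall g, g \in s -> bounded d g.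
Proof.
elim: s => [|[n x] s [d dP]]; first by exists 0%N.
have [c cP] : exists c, forall i, (absz x@_i <= c)%N /\ (x@_i != 0 -> (absz i <= c)%N).
  pose f i := maxn (absz x@_i) (absz i).
  exists (\max_(i <- msupp x) f i) => i.
  case: (msuppP x i) => [xi|xi]; last by rewrite eqxx.
  have : (f i <= \max_(i <- msupp x) f i)%N.
    by rewrite (big_fsetD1 i) //= leq_maxl.
  by rewrite geq_max => /andP[].
exists (maxn (absz n) (maxn c d)) => g; rewrite inE => /predU1P[->|/dP[dg1 dg2]].
  split=> [|i] /=; first exact: leq_maxl.
  by have [c1 c2] := cP i; split=> [|/c2]; lia.
split=> [|i]; first lia.
by have [c1 c2] := dg2 i; split=> [|/c2]; lia.
Qed.

Definition wpairs (r : seq int) (s : seq lau) : seq wreath :=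
  allpairs (fun n x => (n, x) : wreath) r s.

Lemma mem_wpairs r s (g : wreath) : (g \in wpairs r s) = (g.1 \in r) && (g.2 \in s).
Proof.
apply/allpairsP/andP => [[[n x] [nr xs ->]]|[g1 g2]] //.
by exists (g.1, g.2); case: (g) g1 g2.
Qed.

Lemma size_wpairs r s : size (wpairs r s) = (size r * size s)%N.
Proof. exact: size_allpairs. Qed.

Lemma uniq_wpairs r s : uniq r -> uniq s -> uniq (wpairs r s).
Proof. by move=> ur us; apply: allpairs_uniq => // -[n x] [m y] _ _ [-> ->]. Qed.

(* Følner's condition, with sets of the form
   {z^n x | 0 <= n < N, x in a box of side M}. *)
Lemma folner (s : seq wreath) : exists A B : seq wreath,
  [/\ uniq A, (size B < size A + size A)%N &
      forall g h, g \in s -> h \in A -> wmul g h \in B].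
Proof.
have [d dP] := seq_bounded s.
(* The degree range grows by the factor (10d+1)/(8d+1) < 5/4 and, for large [M], the box by at most
   3/2; the product stays below 2. The number [w] of coordinates depends on [d] alone, so [M] can be
   chosen after it. *)
pose N := (8 * d).+1; have [w wE] : { w | w = (N + d + d).+1 } by exists (N + d + d).+1.
have [K KP] := expn_shift_ratio (d + d) w 2.
(* The window [W] contains all translates of [-d, d] by degrees n with 0 <= n < N. *)
pose M := K.+1; pose W := int_range (- d%:Z) w.
have uW : uniq W by apply: uniq_int_range.
exists (wpairs (int_range 0 N) (box W 0 M)).
exists (wpairs (int_range (- d%:Z) (N + d + d)) (box W (- d%:Z) (M + (d + d)))).
split.
- by apply: uniq_wpairs; rewrite ?uniq_int_range ?uniq_box.
- rewrite !size_wpairs !size_box !size_int_range.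
  have := KP M (leqnSn K); have : (0 < M ^ w)%N by rewrite expn_gt0.
  move: (M ^ w)%N ((M + (d + d)) ^ w)%N => a c a0 /(leq_mul (leqnn (10 * d).+1)).
  move=> le_ca; rewrite -(ltn_pmul2l (isT : (0 < 2)%N)) /N.
  have -> : (2 * (((8 * d).+1 + d + d) * c) = (10 * d).+1 * (2 * c))%N by ring.
  have -> : (2 * ((8 * d).+1 * a + (8 * d).+1 * a) =
             (10 * d).+1 * (3 * a) + (2 * d).+1 * a)%N by ring.
  by apply: leq_ltn_trans le_ca _; rewrite -[ltnLHS]addn0 ltn_add2l muln_gt0.
move=> g h /dP[g1 g2]; rewrite !mem_wpairs => /andP[nr xb].
case: h nr xb => n x /= nr xb; apply/andP; split.
  by move: nr; rewrite !mem_int_range; lia.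
move/(mem_box _ _ _ uW): xb => xb; apply/(mem_box _ _ _ uW) => i.
have := xb i; have [] := g2 (i - n); rewrite mcoeffD mcoeff_shift.
move: nr; rewrite mem_int_range !mem_int_range.
case: ifP => [_ _ + _|iW nr c1 c2 ->].
  by move: (g.2@__) (x@__) => a c; lia.
have [-> //|/c2] := eqVneq (g.2@_(i - n)) 0.
by move: iW nr; rewrite wE; lia.
Qed.

(** * The right Ore condition *)

Section Ore.
Variables (F : fieldType) (b : twist F).
Implicit Types x y : tga b.

(* A nontrivial solution of [x * u = y * v] exists because it is a linear system with
   more unknowns than equations. *)
Theorem tga_ore x y : x != 0 -> y != 0 -> exists u v, x * u = y * v /\ x * u != 0.
Proof.
move=> x0 y0.
have [A [B [uA ltBA AB]]] := folner (enum_fset (tsupp x) ++ enum_fset (tsupp y)).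
set m := size A in ltBA; set n := size B in ltBA.
pose p (i : 'I_m) := tmon b (nth wone A i) 1.
pose row_of z := \matrix_(i < m, j < n) tcoef (nth wone B j) (z * p i).
(* The unknowns are the coefficients of [u] and [v] on [A], the equations are indexed by [B]. The
   sign turns a left kernel vector into a solution of [x * u = y * v]. *)
pose M := col_mx (row_of x) (- row_of y).
have : kermx M != 0.
  rewrite kermx_eq0 /row_free; apply: contraTneq ltBA => e.
  by rewrite -leqNgt -[X in (X <= _)%N]e rank_leq_col.
move=> /rowV0Pn[v /sub_kermxP vM v0].
pose vl := lsubmx v; pose vr := rsubmx v.
pose comb (c : 'rV[F]_m) : tga b := \sum_i tconst b (c 0 i) * p i.
have coef_comb c (i : 'I_m) : tcoef (nth wone A i) (comb c) = c 0 i.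
  rewrite raddf_sum (bigD1 i) //= big1 ?addr0 => [|j ji].
    by rewrite -tmonE tcoef_mon eqxx.
  by rewrite -tmonE tcoef_mon nth_uniq // (negPf ji : (j == i :> nat) = false).
have coef_mul z c (j : 'I_n) :
    tcoef (nth wone B j) (z * comb c) = (c *m row_of z) 0 j.
  rewrite mulr_sumr raddf_sum mxE; apply: eq_bigr => i _ /=.
  by rewrite mulrA -tconst_central -mulrA tcoefZ mxE.
(* Outside [B] both products vanish, so the equations indexed by [B] suffice. *)
have supp_mul z c g : z \in [:: x; y] -> g \notin B -> tcoef g (z * comb c) = 0.
  move=> zxy gB; rewrite mulr_sumr raddf_sum big1 // => i _ /=.
  apply/eqP/negPn/negP => /tcoefM[h [l [zh]]].
  rewrite -tmonE tcoef_mon; have [<- _|_] := eqVneq (nth wone A i) l; last by rewrite mulr0n eqxx.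
  move=> e; case/negP: gB; rewrite e; apply: AB; last exact: mem_nth.
  move: zxy zh; rewrite mem_cat !inE => /orP[]/eqP-> zh; apply/orP; [left|right].
    by move: zh; rewrite -tsuppE.
  by move: zh; rewrite -tsuppE.
have {}vM : vl *m row_of x = vr *m row_of y.
  apply/eqP; rewrite -subr_eq0 -mulmxN -mul_row_col hsubmxK.
  exact/eqP.
have e : x * comb vl = y * comb vr.
  apply: tcoefP => g; have [gB|gB] := boolP (g \in B); last first.
    have xs : x \in [:: x; y] by rewrite inE eqxx.
    have ys : y \in [:: x; y] by rewrite !inE eqxx orbT.
    by transitivity (0 : F); [exact: (supp_mul x vl g xs gB)|exact/esym/(supp_mul y vr g ys gB)].
  have ltj : (index g B < n)%N by rewrite index_mem.
  rewrite -(nth_index wone gB).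
  apply: etrans (coef_mul x vl (Ordinal ltj)) _.
  by apply: etrans _ (esym (coef_mul y vr (Ordinal ltj))); rewrite vM.
have vl0_or : vl != 0 \/ vr != 0.
  have [vl0|] := eqVneq vl 0; [right|by left].
  apply: contraNneq v0 => vr0; rewrite -(hsubmxK v) -/vl -/vr vl0 vr0.
  by rewrite row_mx0.
have comb_neq0 c : c != 0 -> comb c != 0.
  apply: contraNneq => c0; apply/eqP/rowP => i; rewrite mxE.
  by rewrite -coef_comb c0 raddf0.
exists (comb vl), (comb vr); split; first exact: e.
case: vl0_or => /comb_neq0 c0.
  exact: tga_domain.
by rewrite e; apply: tga_domain.
Qed.
End Ore.

(** * Simplicity of the twisted group algebra *)

Section Simple.
Variables (F : fieldType) (b : twist F).
Implicit Types x y : tga b.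

(** Conjugation by the monomial at [c], up to the scalar [(bichar b c c)^-1]. Terms of degree 0 in
    [z] stay in place and are rescaled; a term of degree [n] moves by [shift n c - c]. *)
Definition tconj (c : lau) x : tga b := tmon b (0, c) 1 * x * tmon b (0, - c) 1.

Definition tconj_factor (c : lau) (g : wreath) : F :=
  cocyc b (0, c) g * cocyc b (wmul (0, c) g) (0, - c).

Lemma tcoef_conj c x n e :
  tcoef (n, shift n c + e - c) (tconj c x) = tcoef (n, e) x * tconj_factor c (n, e).
Proof.
have -> : (n, shift n c + e - c) = wmul (wmul (0, c) (n, e)) (0, - c) :> wreath.
  by rewrite /wmul /= add0r addr0 shift0.
by rewrite tcoef_Ur mulr1 tcoef_Ul mul1r mulrA.
Qed.

Lemma tconj_factor_neq0 c g : tconj_factor c g != 0.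
Proof. by rewrite mulf_neq0 ?cocyc_neq0. Qed.

Lemma tconj_factor0 c e :
  tconj_factor c (0, e) = bichar b c e / bichar b e c / bichar b c c.
Proof.
rewrite /tconj_factor /cocyc /= !shift0 bicharDl !bicharNr.
by rewrite -mulrA [_^-1 * _]mulrC.
Qed.

Lemma tcoef_conj0 c x e :
  tcoef (0, e) (tconj c x) = tcoef (0, e) x * tconj_factor c (0, e).
Proof. by rewrite -tcoef_conj shift0 addrC addKr. Qed.

Lemma tcoef_conj_deg c x g : tcoef g (tconj c x) != 0 ->
  exists h, h.1 = g.1 /\ tcoef h x != 0.
Proof.
case: g => n e; have -> : e = shift n c + (e + c - shift n c) - c.
  by rewrite addrCA subrr addr0 addrK.
rewrite tcoef_conj mulf_eq0 negb_or => /andP[x0 _].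
by exists (n, e + c - shift n c).
Qed.

Section Ideal.
Variable J : tga b -> Prop.
Hypotheses (JD : forall x y, J x -> J y -> J (x + y))
  (JMl : forall a x, J x -> J (a * x)) (JMr : forall a x, J x -> J (x * a)).
Hypothesis nondeg : forall e, e != 0 -> exists c, bichar b c e != bichar b e c.

Let JB x y : J x -> J y -> J (x - y).
Proof. by move=> Jx Jy; apply: JD => //; rewrite -mulN1r; apply: JMl. Qed.

Let Jconj c l x : J x -> J (tconj c x - tconst b l * x).
Proof. by move=> Jx; apply: JB; [apply/JMr/JMl|apply: JMl]. Qed.

Let conj_deg c l x g : tcoef g (tconj c x - tconst b l * x) != 0 ->
  exists h, h.1 = g.1 /\ tcoef h x != 0.
Proof.
rewrite raddfB /= tcoefZ => yg.
have [x0|] := eqVneq (tcoef g x) 0; last by exists g.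
by move: yg; rewrite x0 mulr0 subr0; apply: tcoef_conj_deg.
Qed.

Definition supp0 x := [seq g <- enum_fset (tsupp x) | g.1 == 0].

Lemma mem_supp0 x g : (g \in supp0 x) = (g.1 == 0) && (tcoef g x != 0).
Proof. by rewrite mem_filter -tsuppE. Qed.

Lemma uniq_supp0 x : uniq (supp0 x).
Proof. by rewrite filter_uniq ?fset_uniq. Qed.

(* Nondegeneracy of the commutator pairing makes conjugation by the base group separate the terms
   of degree 0, so all of them but one can be cancelled. *)
Lemma ideal_deg0 x : J x -> tcoef wone x != 0 ->
  exists y, [/\ J y, tcoef wone y != 0, (forall e, e != 0 -> tcoef (0, e) y = 0)
    & forall g, tcoef g y != 0 -> exists h, h.1 = g.1 /\ tcoef h x != 0].
Proof.
have [m] := ubnP (size (supp0 x)); elim: m x => // m IH x lt_m Jx x1.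
have [[e [e0 xe]]|no] := pselect (exists e, e != 0 /\ tcoef (0, e) x != 0); last first.
  exists x; split=> // [e e0|g]; last by exists g.
  by apply/eqP/negPn/negP => xe; apply: no; exists e.
(* Subtracting [l] times [x] kills the term at [e]. The identity term survives, because by the
   choice of [c] its factor differs from [l]. *)
have [c ce] := nondeg e0; pose l := tconj_factor c (0, e).
pose y := tconj c x - tconst b l * x.
have y0 d : tcoef (0, d) y = tcoef (0, d) x * (tconj_factor c (0, d) - l).
  by rewrite raddfB /= tcoef_conj0 tcoefZ mulrBr [l * _]mulrC.
have Jy : J y by apply: Jconj.
have y1 : tcoef wone y != 0.
  rewrite y0 mulf_neq0 // /l !tconj_factor0 bichar0l bichar0r divr1 mul1r.
  rewrite subr_eq0 eq_sym -[X in _ == X]mul1r (inj_eq (mulIf _)); last first.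
    by rewrite invr_neq0 ?bichar_neq0.
  apply: contra ce => /eqP /(canRL (mulfVK (bichar_neq0 b e c))) ->.
  by rewrite mul1r.
have lt_y : (size (supp0 y) < size (supp0 x))%N.
  have : uniq ((0, e) :: supp0 y : seq wreath).
    by rewrite /= uniq_supp0 mem_supp0 y0 subrr mulr0 !eqxx.
  move/uniq_leq_size; apply=> g; rewrite inE mem_supp0 mem_supp0.
  case: g => n d /predU1P[[-> ->]|/andP[/= /eqP -> yd]]; rewrite eqxx //=.
  by apply: contraNneq yd => x0; rewrite y0 x0 mul0r.
have [z [Jz z1 z0 zd]] := IH y (leq_trans lt_y lt_m) Jy y1.
exists z; split=> // g /zd[h [<- /conj_deg[h' [<- xh']]]].
by exists h'.
Qed.

Definition degs x := undup [seq g.1 | g <- enum_fset (tsupp x)].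

Lemma mem_degs x n : reflect (exists g, g.1 = n /\ tcoef g x != 0) (n \in degs x).
Proof.
rewrite mem_undup; apply: (iffP mapP) => [[g gx ->]|[g [<- xg]]].
  by exists g; rewrite -tsuppE.
by exists g => //; rewrite -tsuppE in xg.
Qed.

(** Induction on the number of degrees in [z]. Once degree 0 is reduced to the identity term, a
    conjugation cancels that term while moving some term of another degree off the support; the
    difference is nonzero and has fewer degrees. If degree 0 is the only one, a nonzero scalar
    remains. *)
Theorem tga_simple x : J x -> x != 0 -> J 1.
Proof.
move=> Jx0 /tnz[g0 xg0].
(* Multiplication by a monomial translates all degrees alike, so their number does not grow. *)
have move_to_1 z g : J z -> tcoef g z != 0 -> exists y, [/\ J y, tcoef wone y != 0
    & (size (degs y) <= size (degs z))%N].
  move=> Jz zg; exists (tmon b (winv g) 1 * z); split; first exact: JMl.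
    by rewrite -(wmulVg g) tcoef_Ul mul1r mulf_neq0 ?cocyc_neq0.
  rewrite -(size_map (fun n => - g.1 + n) (degs z)); apply: uniq_leq_size.
    exact: undup_uniq.
  move=> n /mem_degs[h [<- yh]]; apply/mapP; exists (wmul g h).1.
    apply/mem_degs; exists (wmul g h); split=> //.
    apply: contraNneq yh => zh; have {1}-> : h = wmul (winv g) (wmul g h).
      by rewrite wmulA wmulVg wmul1.
    by rewrite tcoef_Ul zh mulr0 mul0r.
  by rewrite /= addKr.
have [x1 [Jx1 x11 _]] := move_to_1 _ _ Jx0 xg0.
move: x1 Jx1 x11 => {x Jx0 g0 xg0}.
move=> x; have [m] := ubnP (size (degs x)); elim: m x => // m IH x lt_m Jx x1.
have [y [Jy y1 y0 yd]] := ideal_deg0 Jx x1.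
have [[g [g0 yg]]|no] := pselect (exists g, g.1 != 0 /\ tcoef g y != 0); last first.
  have -> : 1 = tconst b (tcoef wone y)^-1 * y; last exact: JMl.
  apply: tcoefP => -[n e]; rewrite tcoefZ tcoef1.
  case: eqP => [<-|/eqP ne]; first by rewrite mulVf.
  suff -> : tcoef (n, e) y = 0 by rewrite mulr0.
  have [n0|n0] := eqVneq n 0; last first.
    by apply/eqP/negPn/negP => yne; apply: no; exists (n, e).
  rewrite n0 y0 //; apply: contraNneq ne => e0; by rewrite n0 e0.
case: g g0 yg => n e /= n0 yne.
(* Conjugation by these multiples of the generator at 0 adds [k] to coordinate [n] of the term at
   [(n, e)], since [n] is nonzero. The new positions are distinct, and one of them avoids the
   support of [y]. *)
pose c k : lau := << k%:Z *g 0 >>.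
have inj_c : injective (fun k => (n, shift n (c k) + e - c k) : wreath).
  have coef_n k : (shift n (c k) + e - c k)@_n = k%:Z + e@_n.
    rewrite mcoeffB mcoeffD mcoeff_shift subrr mcoeffUU mcoeffU.
    by rewrite eq_sym (negPf n0) subr0.
  move=> k k' /(congr1 (fun g : wreath => g.2@_n)) /=.
  rewrite (coef_n k) (coef_n k') => /addIr e_k; exact: (congr1 absz e_k).
have [k yk] := tsupp_avoid y inj_c.
(* With the factor of the identity as [l], the whole degree 0 part of [z] cancels. *)
pose l := tconj_factor (c k) wone; pose z := tconj (c k) y - tconst b l * y.
have Jz : J z by apply: Jconj.
have z0 d : tcoef (0, d) z = 0.
  rewrite raddfB /= tcoef_conj0 tcoefZ.
  have [->|d0] := eqVneq d 0; first by rewrite mulrC subrr.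
  by rewrite y0 // mul0r mulr0 subrr.
have znz : tcoef (n, shift n (c k) + e - c k) z != 0.
  by rewrite raddfB /= tcoef_conj tcoefZ yk mulr0 subr0 mulf_neq0 ?tconj_factor_neq0.
have [w [Jw w1 le_w]] := move_to_1 _ _ Jz znz.
apply: (IH w) => //; apply: leq_ltn_trans le_w _; apply: (leq_trans _ (lt_m : (_ <= m)%N)).
have /uniq_leq_size : uniq (0 :: degs z).
  rewrite /= undup_uniq andbT; apply/mem_degs => -[[n' d] [/= -> ]].
  by rewrite z0 eqxx.
apply=> i; rewrite inE => /predU1P[->|/mem_degs[h [<- zh]]]; apply/mem_degs.
  by exists wone.
have [h' [<- yh']] := conj_deg zh; have [h'' [<- xh'']] := yd _ yh'.
by exists h''.
Qed.

End Ideal.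
End Simple.

(** * The sparse twist: nondegeneracy and finite generation *)

Section LacunaryTwist.
Variables (F : fieldType) (e : nat -> F).
Hypothesis e_neq0 : forall k, e k != 0.

(** The equality test detects powers of two; it fails at 0, where [logn 2 0] is 0. *)
Definition lacunary (i : int) : F :=
  if i is Posz m then (if m == (2 ^ logn 2 m)%N then e (logn 2 m) else 1) else 1.

Lemma lacunary_neq0 i : lacunary i != 0.
Proof. by case: i => [m|m] /=; [case: ifP|]; rewrite ?oner_neq0. Qed.

Definition lacunary_twist : twist F := Twist lacunary_neq0.

Lemma lacunary_exp k : lacunary (2 ^ k)%N = e k.
Proof. by rewrite /= pfactorK // eqxx. Qed.

Lemma lacunary_le0 i : i <= 0 -> lacunary i = 1.
Proof. by case: i => // -[|m] //=; rewrite logn0. Qed.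

Lemma lacunary1 (i : int) : (forall k, i <> (2 ^ k)%N) -> lacunary i = 1.
Proof.
case: i => // m no; rewrite /lacunary; case: eqP => // em.
by case: (no _ (congr1 Posz em)).
Qed.

(** Any other power of two differs from 2^k by at least 2^(k-1) >= k. *)
Lemma exp2_gap k m d : (absz d < k)%N -> d != 0 -> (2 ^ k)%N%:Z + d <> (2 ^ m)%N.
Proof.
move=> dk d0; have [lt_mk|lt_km|->] := ltngtP m k; last by lia.
- case: k dk lt_mk => // k dk; rewrite ltnS => lt_mk.
  have := leq_pexp2l (isT : (0 < 2)%N) lt_mk; have := ltn_expl k (isT : (1 < 2)%N).
  by rewrite expnS; lia.
have := leq_pexp2l (isT : (0 < 2)%N) lt_km; have := ltn_expl k (isT : (1 < 2)%N).
by rewrite expnS; lia.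
Qed.

Variable a : F.
Hypothesis a_torsionfree : forall n : int, n != 0 -> a ^ n != 1.
Hypothesis a_often : forall K, exists2 k, (K <= k)%N & e k = a.

(* If j is in the support of x and k is large, then the distance from j + 2^k to a point of
   the support is a power of two for the point j only. *)
Lemma lacunary_nondeg (x : lau) : x != 0 ->
  exists c, bichar lacunary_twist c x != bichar lacunary_twist x c.
Proof.
move=> x0; have [j xj] : exists j, x@_j != 0.
  apply: contrapT => no; case/eqP: x0; apply/malgP => j; rewrite mcoeff0.
  by apply/eqP/negPn/negP => xj; apply: no; exists j.
have [d dP] := seq_bounded [:: (0, x) : wreath].
have {dP} [_ dP] := dP _ (mem_head _ _).
have suppP i : x@_i != 0 -> (absz i <= d)%N by case: (dP i) => _; apply.
have [k le_k ek] := a_often (d + d).+1.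
have lt_k := ltn_expl k (isT : (1 < 2)%N).
exists << j + (2 ^ k)%N%:Z >>.
(* As 2^k exceeds 2d, all differences in this order are negative, where the twist is 1. *)
have -> : bichar lacunary_twist x << j + (2 ^ k)%N%:Z >> = 1.
  rewrite bichar_U /expw big_seq big1 // => i xi.
  have {}xi := suppP i (etrans (mcoeff_neq0 _ _) xi).
  rewrite [lacunary_twist _]lacunary_le0 ?exp1rz //.
  by have := suppP j xj; lia.
(* In the other order only the index [j] contributes, with the factor [a ^ x@_j]. *)
rewrite bicharU /expw (big_fsetD1 j) -?mcoeff_neq0 //= big_seq big1 => [|i].
  rewrite mulr1 addrAC subrr add0r.
  by rewrite [X in X ^ _ != _](lacunary_exp k) ek a_torsionfree.
rewrite in_fsetD1 -mcoeff_neq0 => /andP[ij xi].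
rewrite [X in X ^ _](_ : _ = 1) ?exp1rz //.
apply: (@lacunary1 (j + (2 ^ k)%N%:Z - i)) => m.
have -> : j + (2 ^ k)%N%:Z - i = (2 ^ k)%N%:Z + (j - i) by ring.
apply: exp2_gap; last by rewrite subr_eq0 eq_sym.
by have := suppP _ xj; have := suppP _ xi; lia.
Qed.

Hypothesis e_surj : forall c, c != 0 -> exists k, e k = c.

Local Notation b := lacunary_twist.

Let tmon0M (x y : lau) (c d : F) : tmon b (0, x) c * tmon b (0, y) d =
  tmon b (0, x + y) (c * d * bichar b x y).
Proof. by rewrite tmonM /wmul /cocyc /= addr0 shift0. Qed.

(* The commutator of the translates of u by 0 and 2^k is the scalar [e k]. *)
Lemma tga_generated (P : tga b -> Prop) :
  P 0 -> (forall x y, P x -> P y -> P (x + y)) ->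
  (forall x y, P x -> P y -> P (x * y)) ->
  P (tmon b (1, 0) 1) -> P (tmon b (- 1, 0) 1) ->
  P (tmon b (0, << 0 >>) 1) -> P (tmon b (0, - << 0 >>) 1) -> forall x, P x.
Proof.
move=> P0 PD PM Pz PzV Pu PuV.
have P1 : P 1.
  have -> : 1 = tmon b (1, 0) 1 * tmon b (- 1, 0) 1; last exact: PM.
  by rewrite tmonM /wmul /cocyc /= bichar0r !mulr1 raddf0 addr0.
have Pzn n : P (tmon b (n, 0) 1).
  have tzM i j : tmon b (i, 0) 1 * tmon b (j, 0) 1 = tmon b (i + j, 0) 1.
    by rewrite tmonM /wmul /cocyc /= bichar0r !mulr1 raddf0 addr0.
  elim: n => [|n IH|n IH]; first exact: P1.
    by have := PM _ _ IH Pz; rewrite (tzM n 1) -PoszD addn1.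
  by have := PM _ _ IH PzV; rewrite (tzM (- n%:Z) (- 1)) -opprD -PoszD addn1.
have Pshift n x : P (tmon b (0, x) 1) -> P (tmon b (0, shift (- n) x) 1).
  move=> Px; have -> : tmon b (0, shift (- n) x) 1 =
      tmon b (n, 0) 1 * tmon b (0, x) 1 * tmon b (- n, 0) 1.
    rewrite !tmonM /wmul /cocyc /= shift0 add0r !addr0 subrr.
    by rewrite bichar0r bichar0l !mulr1.
  exact: (PM _ _ (PM _ _ (Pzn n) Px) (Pzn (- n))).
have Pun n : P (tmon b (0, << n >>) 1).
  by have := Pshift (- n) _ Pu; rewrite shiftU opprK add0r.
have PunV n : P (tmon b (0, - << n >>) 1).
  by have := Pshift (- n) _ PuV; rewrite raddfN /= shiftU opprK add0r.
have Pc c : P (tconst b c).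
  have [->|/e_surj[k <-]] := eqVneq c 0; first by rewrite raddf0.
  pose n := (2 ^ k)%N%:Z.
  have -> : tconst b (e k) = tmon b (0, << n >>) 1 * tmon b (0, << 0 >>) 1 *
      tmon b (0, - << n >>) 1 * tmon b (0, - << 0 >>) 1; last first.
    exact: (PM _ _ (PM _ _ (PM _ _ (Pun n) (Pun 0)) (PunV n)) (PunV 0)).
  rewrite !tmon0M [<< n >> + _]addrC addrK subrr.
  rewrite !bicharNr bicharDl !bicharUU !subrr sub0r subr0.
  rewrite [b 0]lacunary_le0 // [b (- n)]lacunary_le0 ?oppr_le0 //.
  by rewrite [b n]lacunary_exp !(mul1r, mulr1, invr1).
have PU x c : P (tmon b (0, x) 1) -> P (tmon b (0, x) c).
  by move=> Px; rewrite tmonE; exact: (PM _ _ (Pc c) Px).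
have PV x y : P (tmon b (0, x) 1) -> P (tmon b (0, y) 1) -> P (tmon b (0, x + y) 1).
  (* The product of the monomials carries the factor [bichar b x y], which an available scalar
     cancels. *)
  move=> Px Py; rewrite -(mulVf (bichar_neq0 b x y)).
  have -> : (bichar b x y)^-1 * bichar b x y = (bichar b x y)^-1 * 1 * bichar b x y.
    by rewrite mulr1.
  by rewrite -tmon0M; exact: (PM _ _ (PU _ _ Px) Py).
have Px x : P (tmon b (0, x) 1).
  rewrite [x]monalgE; apply: (big_ind (fun x => P (tmon b (0, x) 1))) => [|y z|i _].
  - exact: P1.
  - exact: PV.
  elim: (x@_i) => [|n IH|n IH]; first by rewrite monalgU0; exact: P1.
    by rewrite -addn1 PoszD monalgUD; exact: (PV _ _ IH (Pun i)).
  by rewrite -addn1 PoszD opprD monalgUD (monalgUN i 1); exact: (PV _ _ IH (PunV i)).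
elim/tga_ind => // -[n x] c.
have -> : tmon b (n, x) c = tmon b (n, 0) 1 * tmon b (0, x) c.
  rewrite tmonM /wmul /cocyc /= shift0 add0r addr0 bichar0l mulr1 mul1r //.
exact: (PM _ _ (Pzn n) (PU _ _ (Px x))).
Qed.

End LacunaryTwist.

(** * Subrings containing central scalars, as algebras *)

Record csubring (K : fieldType) (R : nzRingType) := CSubring {
  cscalar : {rmorphism K -> R};
  cmem : R -> Prop;
  cscalarC : forall c x, cscalar c * x = x * cscalar c;
  cmem_scalar : forall c, cmem (cscalar c);
  cmemB : forall x y, cmem x -> cmem y -> cmem (x - y);
  cmemM : forall x y, cmem x -> cmem y -> cmem (x * y) }.

Section CSubalg.
Variables (K : fieldType) (R : nzRingType) (S : csubring K R).

Definition cpred : pred R := fun x => `[< cmem S x >].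

(** One construction serves both the algebra [k + wT] and its scalar extension, over different
    fields. *)
Record csubalg := CSubalg { csval :> R; csvalP : cpred csval }.
HB.instance Definition _ := [isSub for csval].
HB.instance Definition _ := [Choice of csubalg by <:].

Lemma cpred_subring_closed : subring_closed cpred.
Proof.
split=> [|x y /asboolP Sx /asboolP Sy|x y /asboolP Sx /asboolP Sy]; apply/asboolP.
- by rewrite -(rmorph1 (cscalar S)); apply: cmem_scalar.
- exact: cmemB.
exact: cmemM.
Qed.

HB.instance Definition _ := GRing.SubChoice_isSubNzRing.Build R cpred csubalg
  cpred_subring_closed.

Lemma cpredZ c (x : csubalg) : cpred (cscalar S c * val x).
Proof. by apply/asboolP/cmemM; [apply: cmem_scalar|apply/asboolP/csvalP]. Qed.

Definition cscale c (x : csubalg) : csubalg := CSubalg (cpredZ c x).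

Lemma cscaleA c d x : cscale c (cscale d x) = cscale (c * d) x.
Proof. by apply: val_inj; rewrite /= rmorphM mulrA. Qed.

Lemma cscale1 : left_id 1 cscale.
Proof. by move=> x; apply: val_inj; rewrite /= rmorph1 mul1r. Qed.

Lemma cscaleDr : right_distributive cscale +%R.
Proof. by move=> c x y; apply: val_inj; rewrite /= mulrDr. Qed.

Lemma cscaleDl x : {morph cscale^~ x : c d / c + d}.
Proof. by move=> c d; apply: val_inj; rewrite /= rmorphD mulrDl. Qed.

HB.instance Definition _ := GRing.Zmodule_isLmodule.Build K csubalg
  cscaleA cscale1 cscaleDr cscaleDl.

Lemma cscaleAl c (x y : csubalg) : c *: (x * y) = c *: x * y.
Proof. by apply: val_inj; rewrite /= mulrA. Qed.

HB.instance Definition _ := GRing.Lmodule_isLalgebra.Build K csubalg cscaleAl.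

Lemma cscaleAr c (x y : csubalg) : c *: (x * y) = x * (c *: y).
Proof. by apply: val_inj; rewrite /= mulrA cscalarC mulrA. Qed.

HB.instance Definition _ := GRing.Lalgebra_isAlgebra.Build K csubalg cscaleAr.

Lemma csval_lin_comb n (c : 'I_n -> K) (s : 'I_n -> csubalg) :
  val (lin_comb c s) = \sum_i cscalar S (c i) * val (s i).
Proof. exact: raddf_sum. Qed.

Lemma csubalg_mem (x : csubalg) : cmem S (val x).
Proof. exact/asboolP/csvalP. Qed.

End CSubalg.

(** * The algebra [k + wR] inside a simple Ore domain [R] *)

Section Idealizer.
Variables (k : fieldType) (R : nzRingType) (s : {rmorphism k -> R}) (w : R).
Hypothesis sC : forall c x, s c * x = x * s c.

Definition imem (x : R) : Prop := exists c y, x = s c + w * y.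

Lemma imem_scalar c : imem (s c).
Proof. by exists c, 0; rewrite mulr0 addr0. Qed.

Lemma imemB x y : imem x -> imem y -> imem (x - y).
Proof.
move=> [c [x' ->]] [d [y' ->]]; exists (c - d), (x' - y').
by rewrite rmorphB mulrBr opprD addrACA.
Qed.

Lemma imemM x y : imem x -> imem y -> imem (x * y).
Proof.
(* For central c and d: (c + wx')(d + wy') = cd + w(cy' + x'd + x'wy'). *)
move=> [c [x' ->]] [d [y' ->]]; exists (c * d), (s c * y' + x' * s d + x' * w * y').
rewrite rmorphM !(mulrDl, mulrDr) !mulrA (sC c w) !addrA.
by congr (_ + _); rewrite -!addrA; congr (_ + _).
Qed.

Definition idealizer : csubring k R := CSubring sC imem_scalar imemB imemM.

Local Notation A := (csubalg idealizer).

Lemma imem_w y : imem (w * y).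
Proof. by exists 0, y; rewrite rmorph0 add0r. Qed.

Definition iw (y : R) : A := CSubalg (asboolT (imem_w y) : cpred idealizer (w * y)).

Lemma iwP (x : A) : exists c y, x = c *: 1 + iw y.
Proof.
have [c [y xE]] := csubalg_mem x; exists c, y; apply: val_inj.
by rewrite /= mulr1.
Qed.

Hypothesis domR : forall x y : R, x != 0 -> y != 0 -> x * y != 0.
Hypothesis oreR : forall x y : R, x != 0 -> y != 0 ->
  exists u v, x * u = y * v /\ x * u != 0.
Hypothesis simpleR : forall x : R, x != 0 ->
  exists l : seq (R * R), 1 = \sum_(p <- l) p.1 * x * p.2.
Hypothesis w_neq0 : w != 0.
Hypothesis w_nonunit : forall x, w * x != 1.

Lemma mulA_neq0 (x y : A) : x != 0 -> y != 0 -> x * y != 0.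
Proof. by rewrite -!(inj_eq val_inj) /=; apply: domR. Qed.

(** The Ore condition of [R] is applied to [x * w] and [y * w]; the multipliers [w * u] and [w * v]
    then lie in the subalgebra. *)
Lemma idealizer_ore (x y : A) : x != 0 -> y != 0 ->
  exists u v, x * u = y * v /\ x * u != 0.
Proof.
rewrite -(inj_eq val_inj) -[y == 0](inj_eq val_inj) => x0 y0.
have [u [v [e nz]]] := oreR (domR x0 w_neq0) (domR y0 w_neq0).
exists (iw u), (iw v); split; first by apply: val_inj; rewrite /= !mulrA.
by rewrite -(inj_eq val_inj) /= mulrA.
Qed.

(** Nonzero right ideals meet by the Ore condition, and in a domain a right annihilator is zero or
    everything. *)
Lemma idealizer_goldie : right_goldie A.
Proof.
split=> [[I [IP indep]]|S S_inc].
  have [[_ _ IMr0] [x [Ix x0]]] := IP 0%N; have [[_ _ IMr1] [y [Iy y0]]] := IP 1%N.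
  have [u [v [e nz]]] := idealizer_ore x0 y0.
  pose f (i : 'I_2) := if val i is 0%N then x * u else - (y * v).
  have fP (i : 'I_2) : I i (f i).
    case: i => [[|[|//]] lt_i]; first exact: IMr0.
    by rewrite /f /= -mulrN; apply: IMr1.
  have f0 : \sum_i f i = 0 by rewrite big_ord_recl big_ord1 /f /= e subrr.
  by have := indep _ _ fP f0 0; rewrite /f /=; apply/eqP.
have S_mono m n a : (m <= n)%N -> r_ann (S m) a -> r_ann (S n) a.
  by move=> /subnK <-; elim: (n - m)%N => //= i IH Sa; apply/S_inc/IH.
have [[N [a [Sa a0]]]|no] := pselect (exists N a, r_ann (S N) a /\ a != 0); last first.
  exists 0%N => m _ a Sa x Sx.
  have [->|a0] := eqVneq a 0; first by rewrite mulr0.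
  by case: no; exists m, a.
(* A nonzero [a] annihilated by [S N] leaves no nonzero element in [S N], whose annihilator is then
   everything. *)
exists N => m _ c _ x Sx; have [->|x0] := eqVneq x 0; first by rewrite mul0r.
by have := mulA_neq0 x0 a0; rewrite (Sa _ Sx) eqxx.
Qed.

(* If 1 = sum a_i x w b_i then w y = sum (w a_i) x (w b_i y). *)
Lemma ideal_contains_w (I : A -> Prop) : two_sided_ideal I -> nonzero_set I ->
  forall y, I (iw y).
Proof.
move=> [I0 ID _ IMl IMr] [x [Ix x0]] y.
have [l e] := simpleR (domR (x0 : val x != 0) w_neq0).
have -> : iw y = \sum_(p <- l) iw p.1 * x * iw (p.2 * y).
  apply: val_inj; rewrite raddf_sum /= -[y in LHS]mul1r e mulr_suml mulr_sumr.
  by apply: eq_bigr => p _; rewrite !mulrA.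
by apply: big_ind => // p _; apply/IMr/IMl.
Qed.

(** Every nonzero ideal contains [wR], and modulo [wR] the algebra is spanned by 1. *)
Lemma idealizer_codim (I : A -> Prop) : two_sided_ideal I -> nonzero_set I ->
  finite_codim I.
Proof.
move=> I_ideal I_nz; exists 1%N, (fun=> 1) => x; have [c [y ->]] := iwP x.
exists (fun=> c); rewrite /lin_comb big_ord1 [c *: 1 + _]addrC addrK.
exact: ideal_contains_w.
Qed.

(** The ideal is [wR], which is proper as [w] has no right inverse. *)
Lemma idealizer_not_simple : not_simple A.
Proof.
exists (fun x => exists y, x = iw y); split.
- split=> [|_ _ [x ->] [y ->]|c _ [y ->]|x _ [y ->]|x _ [y ->]].
  + by exists 0; apply: val_inj; rewrite /= mulr0.
  + by exists (x + y); apply: val_inj; rewrite /= mulrDr.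
  + by exists (s c * y); apply: val_inj; rewrite /= mulrA sC mulrA.
  + have [c [x' ->]] := iwP x; exists (s c * y + x' * w * y); apply: val_inj.
    by rewrite /= mulr1 mulrDl mulrDr !mulrA (sC c w).
  + by exists (y * val x); apply: val_inj; rewrite /= mulrA.
- exists (iw 1); split; first by exists 1.
  by rewrite -(inj_eq val_inj) /= mulr1.
exists 1 => -[y /(congr1 val) /= e].
by have := w_nonunit y; rewrite -e eqxx.
Qed.

Hypothesis genR : exists G : seq R, forall P : R -> Prop, P 0 -> (forall c, P (s c)) ->
  (forall x y, P x -> P y -> P (x + y)) -> (forall x y, P x -> P y -> P (x * y)) ->
  (forall g, g \in G -> P g) -> forall x, P x.

(* Writing 1 = sum a_i w b_i, a product w b g y with g a generator of R is
   sum (w b g a_i) (w b_i y). *)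
Lemma idealizer_fin_gen : fin_gen_algebra A.
Proof.
have [G GP] := genR; have [l l1] := simpleR w_neq0.
(* The entry 1 in [B] makes the final conclusion concern [w * y] itself. *)
pose B := 1 :: [seq p.2 | p <- l].
pose ys := B ++ [seq bg * p.1 | bg <- [seq b * g | b <- B, g <- G], p <- l].
exists (size ys), (fun i => iw (nth 0 ys i)) => x P [P1 PD PZ PM] Pgen.
have P0 : P 0 by rewrite -(scale0r 1); apply: PZ.
have Pys y : y \in ys -> P (iw y).
  move=> ysy; have lt_i : (index y ys < size ys)%N by rewrite index_mem.
  by have := Pgen (Ordinal lt_i); rewrite /= nth_index.
pose Q y := forall b, b \in B -> P (iw (b * y)).
have QD y z : Q y -> Q z -> Q (y + z).
  move=> Qy Qz b Bb; have -> : iw (b * (y + z)) = iw (b * y) + iw (b * z).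
    by apply: val_inj; rewrite /= !mulrDr.
  by apply: PD; [apply: Qy|apply: Qz].
have Q0 : Q 0.
  by move=> b _; rewrite [iw _](_ : _ = 0) //; apply: val_inj; rewrite /= !mulr0.
have Qgen g y : g \in G -> Q y -> Q (g * y).
  move=> Gg Qy b Bb.
  have -> : iw (b * (g * y)) = \sum_(p <- l) iw (b * g * p.1) * iw (p.2 * y).
    apply: val_inj; rewrite raddf_sum /= -[y in LHS]mul1r l1 mulr_suml !mulr_sumr.
    by apply: eq_bigr => p _; rewrite !mulrA.
  rewrite big_seq; apply: big_ind => // p pl; apply: PM.
    by apply: Pys; rewrite mem_cat; apply/orP; right; do !apply: allpairs_f.
  by apply: Qy; rewrite inE; apply/orP; right; apply: map_f.
(* The induction over generators of [R] is applied to the [y] whose left multiplication preserves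
   [Q], a condition that is closed under products. *)
have QQ y : forall z, Q z -> Q (y * z).
  apply: (GP (fun y => forall z, Q z -> Q (y * z))) =>
    [z _|c z Qz b Bb|x1 x2 Q1 Q2 z Qz|x1 x2 Q1 Q2 z Qz|g Gg z].
  - by rewrite mul0r.
  - have -> : iw (b * (s c * z)) = c *: iw (b * z).
      by apply: val_inj; rewrite /= (mulrA b) -(sC c b) -!mulrA (mulrA w) -(sC c w) -mulrA.
    by apply: PZ; apply: Qz.
  - by rewrite mulrDl; apply: QD; [apply: Q1|apply: Q2].
  - by rewrite -mulrA; apply/Q1/Q2.
  exact: Qgen.
have Q1 : Q 1.
  by move=> b Bb; rewrite mulr1; apply: Pys; rewrite mem_cat Bb.
have [c [y ->]] := iwP x; apply: PD; first exact: PZ.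
by have := QQ y 1 Q1 1 (mem_head _ _); rewrite mul1r mulr1.
Qed.

End Idealizer.

(** * Fraction fields: extension of embeddings, common denominators *)

Section FractionLift.
Variable R : idomainType.
Local Notation tofrac := (@FracField.tofrac R).

Lemma fraction_repr (a : {fraction R}) :
  exists p q, q != 0 /\ a = tofrac p / tofrac q.
Proof.
elim/quotW: a => x; exists \n_x, \d_x; split; first exact: denom_ratioP.
apply: (canRL (mulfK _)); first by rewrite tofrac_eq0 denom_ratioP.
apply/eqP; rewrite !piE /= FracField.equivfE /FracField.mulf /=.
by rewrite !numden_Ratio ?oner_eq0 ?mulr1 ?mul1r ?denom_ratioP // mulrC.
Qed.

Variables (L : fieldType) (f : {rmorphism R -> L}).
Hypothesis f_inj : injective f.

Let f_neq0 q : q != 0 -> f q != 0.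
Proof. by apply: contraNneq => fq; apply/eqP/f_inj; rewrite fq rmorph0. Qed.

(** Cross-multiplication shows that the value f p / f q does not depend on the chosen fraction, so a
    choice of values is a ring morphism. *)
Lemma fraction_lift : exists g : {rmorphism {fraction R} -> L},
  forall x, g (tofrac x) = f x.
Proof.
have g0 (a : {fraction R}) : {c | forall p q, q != 0 -> a = tofrac p / tofrac q ->
    c = f p / f q}.
  apply: cid; have [p [q [q0 ->]]] := fraction_repr a.
  exists (f p / f q) => p' q' q'0 /eqP.
  rewrite eqr_div ?tofrac_eq0 // -!rmorphM tofrac_eq => /eqP e.
  by apply/eqP; rewrite eqr_div ?f_neq0 // -!rmorphM e.
pose g a := sval (g0 a).
have gE p q : q != 0 -> g (tofrac p / tofrac q) = f p / f q.
  by move=> q0; apply: (svalP (g0 _)).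
have g_f x : g (tofrac x) = f x.
  by have := gE x 1 (oner_neq0 _); rewrite !rmorph1 !divr1.
have gB : zmod_morphism g.
  move=> a c; have [p [q [q0 ->]]] := fraction_repr a.
  have [p' [q' [q'0 ->]]] := fraction_repr c.
  rewrite -mulNr addf_div ?tofrac_eq0 // mulNr -!rmorphM -rmorphB.
  by rewrite !gE ?mulf_neq0 // -[in RHS]mulNr [RHS]addf_div ?f_neq0 // mulNr -!rmorphM -rmorphB.
have gM : monoid_morphism g.
  split=> [|a c]; first by rewrite -(rmorph1 tofrac) g_f rmorph1.
  have [p [q [q0 ->]]] := fraction_repr a.
  have [p' [q' [q'0 ->]]] := fraction_repr c.
  by rewrite mulf_div -!rmorphM !gE ?mulf_neq0 // mulf_div -!rmorphM.
pose mA := GRing.isZmodMorphism.Build _ _ g gB.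
pose mM := GRing.isMonoidMorphism.Build _ _ g gM.
pose gr : {rmorphism {fraction R} -> L} := HB.pack g mA mM.
by exists gr.
Qed.

Lemma common_denominator n (c : 'I_n -> {fraction R}) :
  exists q (p : 'I_n -> R), q != 0 /\ forall i, c i = tofrac (p i) / tofrac q.
Proof.
elim: n c => [|n IH] c; first by exists 1, (fun=> 0); rewrite oner_neq0; split=> // -[].
have [q [p [q0 pP]]] := IH (fun i => c (lift ord0 i)).
have [p' [q' [q'0 e]]] := fraction_repr (c ord0).
exists (q * q'), (fun i => oapp (fun j => p j * q') (p' * q) (unlift ord0 i)).
split=> [|i]; first exact: mulf_neq0.
have [q1 q'1] : tofrac q != 0 /\ tofrac q' != 0 by rewrite !tofrac_eq0.
case: unliftP => [j ->|->] /=; rewrite ?pP ?e !rmorphM; first by rewrite -mulf_div divff // mulr1.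
by rewrite [tofrac q * _]mulrC -mulf_div divff // mulr1.
Qed.
End FractionLift.

(** * Infinite dimension of [wT] over [F] *)

Section Unbounded.
Variables (F : fieldType) (b : twist F).

(** Finitely many [s i] have bounded degree in [z], while the multiples of [1 + z] do not. This
    serves both for the dimension of the algebra and for the codimension of the kernel in its scalar
    extension. *)
Lemma tga_unbounded n (s : 'I_n -> tga b) :
  exists y, forall c : 'I_n -> F, (1 + tz b) * y <> \sum_i tconst b (c i) * s i.
Proof.
have [d dP] := seq_bounded (flatten [seq enum_fset (tsupp (s i)) | i <- enum 'I_n]).
exists (tmon b (d.+1%:Z, 0) 1) => c /(congr1 (tcoef (d.+1%:Z, 0))) /eqP.
rewrite tcoef_1z_mul !tcoef_mon eqxx /wmul /= raddf0 addr0.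
have -> : ((d.+1%:Z, 0) == (-1 + d.+1%:Z, 0) :> wreath) = false.
  by apply/negP => /eqP[]; lia.
rewrite mulr0n addr0 raddf_sum big1 ?oner_eq0 // => i _ /=.
rewrite tcoefZ; suff -> : tcoef (d.+1%:Z, 0) (s i) = 0 by rewrite mulr0.
apply/eqP/negPn/negP; rewrite -tsuppE => si.
have [] : bounded d (d.+1%:Z, 0); last by rewrite /= ltnn.
by apply/dP/flatten_mapP; exists i; rewrite ?mem_enum.
Qed.

End Unbounded.

(** * Scalar extensions realized as spans *)

Section SpanExtension.
Variables (k K : fieldType) (iota : {rmorphism k -> K}) (A : algType k) (R : nzRingType).
Variables (s : {rmorphism K -> R}) (f : {rmorphism A -> R}).
Hypothesis sC : forall c x, s c * x = x * s c.
Hypothesis fZ : forall c x, f (c *: x) = s (iota c) * f x.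
Hypothesis f_indep : forall n (x : 'I_n -> A), lin_indep x ->
  forall c : 'I_n -> K, \sum_i s (c i) * f (x i) = 0 -> forall i, c i = 0.

Definition span_mem (x : R) : Prop :=
  exists l : seq (K * A), x = \sum_(p <- l) s p.1 * f p.2.

Lemma span_scalar c : span_mem (s c).
Proof. by exists [:: (c, 1)]; rewrite big_seq1 /= rmorph1 mulr1. Qed.

Lemma spanB x y : span_mem x -> span_mem y -> span_mem (x - y).
Proof.
move=> [l ->] [l' ->]; exists (l ++ [seq (- p.1, p.2) | p <- l']).
rewrite big_cat big_map /= -sumrN; congr (_ + _); apply: eq_bigr => p _.
by rewrite rmorphN mulNr.
Qed.

Lemma spanM x y : span_mem x -> span_mem y -> span_mem (x * y).
Proof.
move=> [l ->] [l' ->]; exists [seq (p.1 * q.1, p.2 * q.2) | p <- l, q <- l'].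
rewrite big_allpairs_dep /= mulr_suml; apply: eq_bigr => p _.
rewrite mulr_sumr; apply: eq_bigr => q _.
by rewrite !rmorphM !mulrA -[_ * f _ * s _]mulrA -sC !mulrA.
Qed.

Definition span_ext : csubring K R := CSubring sC span_scalar spanB spanM.

Lemma span_f x : cpred span_ext (f x).
Proof. by apply/asboolP; exists [:: (1, x)]; rewrite big_seq1 /= rmorph1 mul1r. Qed.

Definition span_phi (x : A) : csubalg span_ext := CSubalg (span_f x).

(** The span is the image of the tensor product in [R]; [f_indep] expresses that the map to [R] is
    injective. *)
Lemma span_scalar_extension : scalar_extension iota span_phi.
Proof.
split; last split.
- split=> [x y|x y||c x]; apply: val_inj => /=.
  + exact: rmorphD.
  + exact: rmorphM.
  + exact: rmorph1.
  exact: fZ.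
- move=> y; have [l yE] := csubalg_mem y.
  exists (size l), (fun i => (nth (0, 0) l i).2), (fun i => (nth (0, 0) l i).1).
  by apply: val_inj; rewrite csval_lin_comb yE (big_nth (0, 0)) big_mkord.
move=> n x x_indep c /(congr1 val); rewrite csval_lin_comb => e.
exact: (f_indep x_indep e).
Qed.
End SpanExtension.

(** * Comparison of two scalar actions *)

Section TwistScalarDiff.
Variables (F F' : fieldType) (b : twist F) (b' : twist F') (h : {rmorphism F -> F'}).

Lemma twist_scalar_diff0 (c : F) (x : tga b) :
  x * tconst b c - tconst b c * (x * 1) = 0.
Proof. by rewrite mulr1 tconst_central subrr. Qed.

(** With [x] equal to [1 + z], this detects a kernel element as nonzero when the two images of the
    scalar differ; the factor 1 comes from [iw] at 1. *)
Lemma twist_scalar_diff (c : F) (c' : F') (x : tga b) : tcoef wone x = 1 ->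
  tcoef wone (tmap h b' (x * tconst b c) - tconst b' c' * tmap h b' (x * 1)) = h c - c'.
Proof.
move=> x1; rewrite (mulr1 x) -(tconst_central c x) [LHS]raddfB; congr (_ - _).
  by rewrite [LHS]tcoef_map tcoefZ x1 mulr1.
by rewrite [LHS]tcoefZ tcoef_map x1 rmorph1 mulr1.
Qed.
End TwistScalarDiff.

(** * The example over a countable field *)

Section Final.
Variable k : countFieldType.

Local Notation F := {fraction {poly k}}.
Local Notation F' := {fraction {poly F}}.
Local Notation frac := (@FracField.tofrac _).

Definition frac_const : {rmorphism k -> F} := frac \o polyC.

(* Every nonzero element is hit infinitely often, because of the dummy nat component. *)
Definition frac_enum (n : nat) : F :=
  let a := if (choice.unpickle n : option ({poly k} * {poly k} * nat)) is Some (p, q, _)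
           then frac p / frac q else 0 in
  if a == 0 then 1 else a.

Lemma frac_enum_neq0 n : frac_enum n != 0.
Proof.
by rewrite /frac_enum; case: ifPn; rewrite ?oner_neq0.
Qed.

Lemma frac_enum_often (a : F) N : a != 0 -> exists2 n, (N <= n)%N & frac_enum n = a.
Proof.
move=> a0; have [p [q [q0 e]]] := fraction_repr a.
pose g (m : nat) := choice.pickle (p, q, m).
have g_inj : injective g by move=> m m' /(pcan_inj choice.pickleK)[].
have [m le_m] : exists m, (N <= g m)%N.
  apply: contrapT => no.
  have sub : {subset [seq g i | i <- iota 0 N.+1] <= iota 0 N}.
    move=> _ /mapP[i _ ->]; rewrite mem_iota ltnNge; apply/negP => le_N.
    by apply: no; exists i.
  have := uniq_leq_size _ sub; rewrite map_inj_uniq ?iota_uniq // => /(_ isT).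
  by rewrite size_map !size_iota ltnn.
exists (g m) => //; rewrite /frac_enum /g choice.pickleK /= -e; case: ifP => // /eqP e0.
by rewrite e0 eqxx in a0.
Qed.

(** Infinite order lets the variable serve as the scalar [a] of [lacunary_nondeg]. *)
Lemma frac_X_torsionfree (n : int) : n != 0 -> (frac 'X : F) ^ n != 1.
Proof.
have X1 m : (frac 'X : F) ^+ m.+1 != 1.
  rewrite -rmorphXn -(rmorph1 frac) tofrac_eq; apply/eqP => /(congr1 (size \o val)).
  by rewrite /= size_polyXn size_poly1.
case: n => [[|m]|m] // _; first exact: X1.
by rewrite NegzE -exprnN invr_eq1 X1.
Qed.

Definition ftwist : twist F := lacunary_twist frac_enum_neq0.

Lemma ftwist'_neq0 i : frac (ftwist i)%:P != 0 :> F'.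
Proof. by rewrite tofrac_eq0 polyC_eq0 twist_neq0. Qed.

(** The same twist, with values regarded as constants of the larger field. *)
Definition ftwist' : twist F' := Twist ftwist'_neq0.

Local Notation T := (tga ftwist).
Local Notation T' := (tga ftwist').
Local Notation w := (1 + tz ftwist).

Definition T_scalar : {rmorphism k -> T} := tconst ftwist \o frac_const.

Lemma T_scalarC c x : T_scalar c * x = x * T_scalar c.
Proof. exact: tconst_central. Qed.

Local Notation A := (csubalg (idealizer w T_scalarC)).

(** Abstract simplicity is applied to the ideal of all such sums. *)
Lemma T_simple (x : T) : x != 0 -> exists l : seq (T * T), 1 = \sum_(p <- l) p.1 * x * p.2.
Proof.
apply: (tga_simple (J := fun y => exists l : seq (T * T), y = \sum_(p <- l) p.1 * x * p.2)).
- by move=> _ _ [l ->] [l' ->]; exists (l ++ l'); rewrite big_cat.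
- move=> a _ [l ->]; exists [seq (a * p.1, p.2) | p <- l].
  by rewrite big_map mulr_sumr; apply: eq_bigr => p _; rewrite !mulrA.
- move=> a _ [l ->]; exists [seq (p.1, p.2 * a) | p <- l].
  by rewrite big_map mulr_suml; apply: eq_bigr => p _; exact/esym/mulrA.
- apply: (lacunary_nondeg frac_enum_neq0 frac_X_torsionfree) => N.
  by apply: frac_enum_often; rewrite tofrac_eq0 polyX_eq0.
by exists [:: (1, 1)]; rewrite big_seq1 mul1r mulr1.
Qed.

Lemma T_gen : exists G : seq T, forall P : T -> Prop, P 0 ->
  (forall c, P (T_scalar c)) -> (forall x y, P x -> P y -> P (x + y)) ->
  (forall x y, P x -> P y -> P (x * y)) -> (forall g, g \in G -> P g) -> forall x, P x.
Proof.
pose G : seq T := [:: tmon ftwist (1, 0) 1; tmon ftwist (- 1, 0) 1;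
  tmon ftwist (0, << 0 >>) 1; tmon ftwist (0, - << 0 >>) 1].
exists G => P P0 _ PD PM Pgen.
have PG i : (i < 4)%N -> P (nth 0 G i) by move=> lt_i; apply/Pgen/mem_nth.
apply: (tga_generated _ P0 PD PM (PG 0 isT) (PG 1 isT) (PG 2 isT) (PG 3 isT)).
by move=> c c0; have [n _ <-] := frac_enum_often 0 c0; exists n.
Qed.

Lemma tcoef_w : tcoef wone w = 1.
Proof.
have := tcoef_1z_mul (1 : T) wone; rewrite mulr1 !tcoef1 => ->.
have /negPf -> : wone != wmul (- 1, 0) wone by apply/eqP => -[].
by rewrite eqxx addr0.
Qed.

Lemma w_neq0 : w != 0.
Proof.
by apply/eqP => w0; have /eqP := tcoef_w; rewrite w0 raddf0 eq_sym oner_eq0.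
Qed.

Lemma A_infinite : ~ finite_dim A.
Proof.
move=> [n [s sP]]; have [y yP] := tga_unbounded (fun i => val (s i)).
have [c /(congr1 val)] := sP (iw w T_scalarC y).
rewrite csval_lin_comb => e; exact: (yP (fun i => frac_const (c i)) e).
Qed.

Lemma A_just_infinite : just_infinite A.
Proof.
split; first exact: A_infinite.
move=> I; apply: idealizer_codim; [exact: tga_domain|exact: T_simple|exact: w_neq0].
Qed.

(** This embedding sends the variable of [F] to the new variable of [F'], instead of embedding [F]
    as constants. *)
Lemma var_change : exists j : {rmorphism F -> F'},
  forall p, j (frac p) = frac (map_poly frac_const p).
Proof.
have inj : injective (@FracField.tofrac {poly F} \o map_poly frac_const).
  apply: inj_comp; last exact: map_poly_inj.
  by move=> p q /eqP; rewrite tofrac_eq => /eqP.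
exact: (fraction_lift inj).
Qed.

(* The extension A (x) F is realized as the F-span of A inside T' x T, where A goes to the
   first factor through the base change t |-> t, while the scalar t acts on the first factor
   as a new variable and on the second one as t. The first projection shows that
   this is the tensor product, and the kernel of the second one is an ideal of infinite
   codimension. *)
Lemma A_not_stable : ~ stably_just_infinite A.
Proof.
have [j jE] := var_change; pose h : {rmorphism F -> F'} := frac \o polyC.
have h_twist i : ftwist' i = h (ftwist i) by [].
have [m1 mM] := tmap_is_monoid_morphism h_twist.
pose f0 (x : A) : T' * T := (tmap h ftwist' (val x), val x).
have fB : zmod_morphism f0.
  by move=> x y; congr pair; apply: raddfB.
have fM : monoid_morphism f0.
  by split=> [|x y]; congr pair; [apply: m1|apply: mM].
pose f : {rmorphism A -> (T' * T)%type} := HB.pack f0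
  (GRing.isZmodMorphism.Build _ _ f0 fB) (GRing.isMonoidMorphism.Build _ _ f0 fM).
pose s0 (c : F) : T' * T := (tconst ftwist' (j c), tconst ftwist c).
have sB : zmod_morphism s0 by move=> c d; rewrite /s0 !rmorphB.
have sM : monoid_morphism s0.
  by split=> [|c d]; rewrite /s0 ?rmorph1 ?rmorphM.
pose s : {rmorphism F -> (T' * T)%type} := HB.pack s0
  (GRing.isZmodMorphism.Build _ _ s0 sB) (GRing.isMonoidMorphism.Build _ _ s0 sM).
have sC c x : s c * x = x * s c.
  case: x => x y; exact: (congr2 pair (tconst_central (j c) x) (tconst_central c y)).
(* The embeddings [h] and [j] agree on [k]. *)
have fZ c x : f (c *: x) = s (frac_const c) * f x.
  congr pair; rewrite [LHS]mM; congr (_ * _).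
  rewrite [LHS]tmapU; congr (tmon _ _ _).
  by rewrite [frac_const c]/(frac c%:P) jE map_polyC.
have f_indep n (x : 'I_n -> A) : lin_indep x ->
    forall c : 'I_n -> F, \sum_i s (c i) * f (x i) = 0 -> forall i, c i = 0.
  move=> x_indep c /(congr1 fst); rewrite raddf_sum /= => e i.
  (* After clearing denominators, each power of the new variable gives a relation over [k], since
     the coefficients of the [x i] are constants in that variable. *)
  have [q [p [q0 cE]]] := common_denominator c.
  suff p0 : p i = 0 by rewrite cE p0 rmorph0 mul0r.
  apply/polyP => n'; rewrite coef0.
  apply: (x_indep (fun i => (p i)`_n')).
  apply: val_inj; rewrite csval_lin_comb; apply: tcoefP => g.
  rewrite !raddf0 raddf_sum /=.
  have e_g : \sum_i frac (map_poly frac_const (p i) * (tcoef g (val (x i)))%:P) = 0.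
    have := congr1 (fun y => j (frac q) * tcoef g y) e.
    rewrite !raddf_sum /= raddf0 mulr0 mulr_sumr => e_g.
    rewrite -[RHS]e_g; apply: eq_bigr => l _.
    rewrite tcoefZ tcoef_map mulrA -rmorphM cE.
    by rewrite [frac q * _]mulrC mulfVK ?tofrac_eq0 // jE rmorphM.
  move: e_g => /eqP; rewrite -rmorph_sum tofrac_eq0 => /eqP/(congr1 (coefp n')).
  rewrite raddf_sum /= coef0 => e_n.
  rewrite -[RHS]e_n; apply: eq_bigr => l _.
  by rewrite tcoefZ coefMC coef_map.
move=> [_ /(_ _ _ _ _ (span_scalar_extension sC fZ f_indep))[_ B_ideal]].
pose B := csubalg (span_ext f sC); pose phi : A -> B := span_phi f sC.
pose J (y : B) : Prop := (val y).2 = 0.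
have J_ideal : two_sided_ideal J.
  split=> [|x y Jx Jy|c x Jx|a x Jx|a x Jx]; rewrite /J /=.
  - by [].
  - by rewrite Jx Jy addr0.
  - by rewrite Jx mulr0.
  - by rewrite Jx mulr0.
  by rewrite Jx mul0r.
have J_nz : nonzero_set J.
  (* The witness is wt (x) 1 - w (x) t. *)
  pose t : F := frac 'X.
  exists (phi (iw w T_scalarC (tconst ftwist t)) - t *: phi (iw w T_scalarC 1)).
  split.
    exact: twist_scalar_diff0.
  apply/eqP => /(congr1 (fun y : B => tcoef wone (val y).1)).
  have -> : tcoef wone (val (0 : B)).1 = 0 by apply: raddf0.
  move/(etrans (esym (twist_scalar_diff ftwist' h t (j t) tcoef_w))) => /eqP.
  (* In the first factor the identity coefficient is the constant [t] minus the new variable;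
     polynomial sizes tell the two apart. *)
  rewrite jE map_polyX subr_eq0 tofrac_eq => /eqP/(congr1 (size \o val)) /=.
  by rewrite size_polyX size_polyC; case: (_ != 0).
(* Finite codimension of the kernel would place [wT] in the [F]-span of finitely many elements of
   [T]. *)
have [n [y yP]] := B_ideal J J_ideal J_nz.
have [z zP] := tga_unbounded (fun i => (val (y i)).2).
have [c] := yP (phi (iw w T_scalarC z)); rewrite /J raddfB /= csval_lin_comb.
rewrite [X in _ - X](raddf_sum (@snd T' T)) => /eqP.
by rewrite subr_eq0 => /eqP/zP.
Qed.

End Final.

Theorem theorem1p4 (k : countClosedFieldType) :
  exists A : algType k,
    [/\ fin_gen_algebra A, right_goldie A, not_simple A, just_infinite A
      & ~ stably_just_infinite A].
Proof.
exists (csubalg (idealizer (1 + tz (ftwist k)) (@T_scalarC k))); split.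
- exact: (idealizer_fin_gen _ (@T_simple k) (w_neq0 k) (T_gen k)).
- exact: (idealizer_goldie _ (@tga_domain _ _) (@tga_ore _ _) (w_neq0 k)).
- exact: (idealizer_not_simple _ (w_neq0 k) (@tga_1z_nonunit _ _)).
- exact: A_just_infinite.
exact: A_not_stable.
Qed.
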